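(* For all integers $n \geq 1$ and $k \geq 1$, the Ehrhart $h^*$-polynomial (with respect to the lattice $\tfrac12\mathbb{Z}^n$) of the half-open type C hypersimplex $\Delta'_{C_n,k}$ is \[ h^*_{\Delta'_{C_n,k}}(t) = \sum_{\substack{w \in X_n \\ \operatorname{fexc}(w) = k-1}} t^{\operatorname{des}_B(w)}. \]
   Context: Signed permutations: $\mathfrak{B}_n$ is the group of bijections $w$ of $\{-n,\dots,-1,1,\dots,n\}$ with $w(-i) = -w(i)$; write $w_i := w(i)$. Let $X_n := \{ w \in \mathfrak{B}_n \mid w^{-1}(1) > 0\}$. Statistics: $\operatorname{des}_B(w)$ is the number of $i \in \{0,1,\dots,n-1\}$ with $w_i > w_{i+1}$, where $w_0 := 0$. $\operatorname{exc}(w) := |\{ i \in [n] : w_i > i\}|$, $\operatorname{neg}(w) := |\{i \in [n] : w_i < 0\}|$, and the flag-excedance is $\operatorname{fexc}(w) := 2\operatorname{exc}(w) + \operatorname{neg}(w)$. Polytopes: $\Pi_{C_n} := \{x \in \mathbb{R}^n \mid 0 \le 2x_1 \le 1,\ 0 \le x_i - x_{i-1} \le 1 \ (2 \le i \le n)\}$. $\Delta'_{C_n,1} := \{x \in \Pi_{C_n} \mid 0 \le 2x_n \le 1\}$ and, for $k \ge 2$, $\Delta'_{C_n,k} := \{ x \in \Pi_{C_n} \mid k-1 < 2x_n \le k\}$ (empty for $k \ge 2n$). Ehrhart theory: for $r \in \mathbb{Z}_{\ge0}$, $rP$ is the set defined by the same (weak/strict) inequalities with all constants multiplied by $r$, and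 $L_P(r) := |rP \cap \tfrac12\mathbb{Z}^n|$. The $h^*$-polynomial is defined by $\sum_{r\ge0} L_P(r)t^r = h^*_P(t)/(1-t)^{n+1}$ (and is $0$ for the empty set). *)

(* Defs.v *)
From HB Require Import structures.
From mathcomp Require Import all_boot all_order all_fingroup all_algebra.
From mathcomp Require Import classical_sets functions cardinality reals.

Set Implicit Arguments.
Unset Strict Implicit.
Unset Printing Implicit Defensive.

Import Order.TTheory GRing.Theory Num.Theory.

Local Open Scope classical_set_scope.
Local Open Scope card_scope.
Local Open Scope ring_scope.

(* The set {-n, ..., -1, 1, ..., n}: the pair (i, b) encodes i + 1 when
   b = false and -(i + 1) when b = true (elements of 'I_n start at 0). *)
Definition signed_idx (n : nat) : finType := ('I_n * bool)%type.

Definition sval_int (n : nat) (a : signed_idx n) : int :=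
  if a.2 then - (a.1.+1)%:Z else (a.1.+1)%:Z.

Definition sopp (n : nat) (a : signed_idx n) : signed_idx n := (a.1, ~~ a.2).

Lemma sval_int_sopp (n : nat) (a : signed_idx n) :
  sval_int (sopp a) = - sval_int a.
Proof. by case: a => i [] //=; rewrite /sval_int /= opprK. Qed.

Lemma sval_int_inj (n : nat) : injective (@sval_int n).
Proof.
by move=> [i b] [j c]; rewrite /sval_int; case: b; case: c => //= [] [eij];
  congr pair; apply: val_inj.
Qed.

Lemma sval_intP (n : nat) (z : int) :
  (exists a : signed_idx n, sval_int a = z) <-> (0 < `|z| <= n)%N.
Proof.
split=> [[[i b] <-]|].
  by rewrite /sval_int; case: b => /=; rewrite ?abszN /= ltn_ord.
case: z => [[|m]|m] //= lt_mn.
- by exists (Ordinal lt_mn, false).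
- by exists (Ordinal lt_mn, true); rewrite /sval_int /= NegzE.
Qed.

Definition signed_perms (n : nat) : {set {perm signed_idx n}} :=
  [set w : {perm signed_idx n} | [forall a, w (sopp a) == sopp (w a)]]%SET.

(* The value w_i, for 0 <= i <= n, with w_0 = 0. *)
Definition sentry (n : nat) (w : {perm signed_idx n}) (i : nat) : int :=
  nth 0 (0 :: [seq sval_int (w (j, false)) | j <- enum 'I_n]) i.

(* The signed permutations w such that w^-1(1) > 0.  When n >= 1 there is
   exactly one a with sval_int a = 1. *)
Definition Xset (n : nat) : {set {perm signed_idx n}} :=
  [set w in signed_perms n |
    [forall a, (sval_int a == 1) ==> (0 < sval_int ((w^-1)%g a))]]%SET.

(* In desB, i ranges over {0, ..., n-1}; in exc and neg, the index of the
   mathematical definition, which ranges over {1, ..., n}, is i.+1. *)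
Definition desB (n : nat) (w : {perm signed_idx n}) : nat :=
  #|[pred i : 'I_n | sentry w i > sentry w i.+1]|.

Definition exc (n : nat) (w : {perm signed_idx n}) : nat :=
  #|[pred i : 'I_n | sentry w i.+1 > (i.+1)%:Z]|.

Definition neg (n : nat) (w : {perm signed_idx n}) : nat :=
  #|[pred i : 'I_n | sentry w i.+1 < 0]|.

Definition fexc (n : nat) (w : {perm signed_idx n}) : nat :=
  (2 * exc w + neg w)%N.

(* The r-th dilates r Pi_{C_n} and r Delta'_{C_n,k}: all constants of the
   defining inequalities are multiplied by r, strict inequalities staying
   strict (also for r = 0).  The polytopes themselves are the case r = 1.
   The coordinate x_i is x 0 (i-1), and the coordinates x_1 and x_n are
   selected by i = 0 and i.+1 = n. *)
Definition PiC (R : realType) (n r : nat) : set 'rV[R]_n :=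
  [set x : 'rV[R]_n | (forall i : 'I_n, i = 0%N :> nat -> 0 <= 2 * x 0 i <= r%:R) /\
           (forall i j : 'I_n, j = i.+1 :> nat -> 0 <= x 0 j - x 0 i <= r%:R)].

Definition DeltaC (R : realType) (n k r : nat) : set 'rV[R]_n :=
  [set x : 'rV[R]_n | PiC r x /\
    forall i : 'I_n, i.+1 = n ->
      if k == 1%N then 0 <= 2 * x 0 i <= r%:R
      else (k%:R - 1) * r%:R < 2 * x 0 i <= k%:R * r%:R].

Definition half_lattice (R : realType) (n : nat) : set 'rV[R]_n :=
  [set x : 'rV[R]_n | forall i : 'I_n, exists z : int, x 0 i = z%:~R / 2].

(* \sum_(r >= 0) a_r t^r = p / q as formal power series, for q with
   invertible constant coefficient: the Cauchy product of q and a is p. *)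
Definition genfun_ratio (a : nat -> int) (p q : {poly int}) : Prop :=
  forall m : nat, \sum_(i < m.+1) q`_i * a (m - i)%N = p`_m.

(* h is the h^*-polynomial, with respect to the lattice (1/2)Z^n, of the
   subset of R^n whose r-th dilate is P r.  The lattice point count L r is
   required to be the actual (finite) cardinality; h is unique, and is 0 if
   all the P r are empty. *)
Definition is_hstar (R : realType) (n : nat) (P : nat -> set 'rV[R]_n)
    (h : {poly int}) : Prop :=
  exists2 L : nat -> nat,
    forall r, P r `&` @half_lattice R n #= `I_(L r) &
    genfun_ratio (fun r => (L r)%:Z) h ((1 - 'X) ^+ n.+1).

(* Main.v *)
(* Fix the dilation factor r.  A pair (w, f), where f is a weakly increasing
   sequence in [0, r] that increases strictly at the descents of w (there are
   'C(r + n - des_B w, n) of them), is the same as a word in [-r, r]^n whose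
   standardization is w; the condition w \in X_n says that the first letter is
   nonnegative.  Adding to f_i the bit "i is an excedance of w" gives a weakly
   increasing sequence of levels in [0, r].  Reading the i-th letter as a step
   out of the i-th level, of weight
     [l <= x] + s [0 < x] + s^2 [0 < x <= l]   from l to x,
   every level is entered as often as it is left, and no level begins with a
   loop of weight s^2; each word has exactly one such sequence of levels, and
   the product of the weights is s^fexc(w).
   As in MacMahon's master theorem, following the steps out of one level after
   the other shows that these balanced systems of steps have the same weight
   as the walks of length n with the same step weights.  Such a walk records
   modulo r the partial sums of an integer point d of [0, r] x [0, 2r]^(n-1),
   and its weight is s^(k-1) with (k-1) r < sum d <= k r; these d are the
   successive differences of the points 2x, for x in r Delta'_{C_n,k}. *)

Require Import Defs.
From mathcomp Require Import all_boot all_order all_fingroup all_algebra.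
From mathcomp Require Import classical_sets functions cardinality reals.
From mathcomp Require Import zify ring.
Import Order.TTheory GRing.Theory Num.Theory.
Local Open Scope ring_scope.

Set Implicit Arguments.
Unset Strict Implicit.
Unset Printing Implicit Defensive.

(** * Sequences and coefficients of products of linear forms *)

Section Shift.
Variables (K : comNzRingType) (s : K).

Definition shift (a : nat -> K) (n : nat) : K := if n is n'.+1 then a n' else 0.

(* Multiplication of the generating function of a by 1 - s^2 z. *)
Definition dshift (a : nat -> K) (n : nat) : K := a n - s ^+ 2 * shift a n.

Lemma eq_dshift (a b : nat -> K) : a =1 b -> dshift a =1 dshift b.
Proof. by move=> ab [|n]; rewrite /dshift /= !ab. Qed.

Lemma eq_iter_dshift q (a b : nat -> K) :
  a =1 b -> iter q dshift a =1 iter q dshift b.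
Proof. by move=> ab; elim: q => [//|q IH] n /=; apply: eq_dshift. Qed.

Lemma iter_dshift0 q n : iter q dshift (fun=> 0) n = 0.
Proof.
elim: q n => [//|q IH] n /=; rewrite (eq_dshift IH) /dshift.
by case: n => [|n] /=; rewrite mulr0 subr0.
Qed.

Lemma iter_dshiftD q (a b : nat -> K) n :
  iter q dshift (fun n => a n + b n) n = iter q dshift a n + iter q dshift b n.
Proof.
elim: q n => [//|q IH] n /=; rewrite (eq_dshift IH) /dshift.
by case: n => [|n] /=; ring.
Qed.

Lemma iter_dshiftZ q (c : K) (a : nat -> K) n :
  iter q dshift (fun n => c * a n) n = c * iter q dshift a n.
Proof.
elim: q n => [//|q IH] n /=; rewrite (eq_dshift IH) /dshift.
by case: n => [|n] /=; ring.
Qed.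

Lemma iter_dshift_sum q (I : finType) (a : I -> nat -> K) n :
  iter q dshift (fun n => \sum_i a i n) n = \sum_i iter q dshift (a i) n.
Proof.
elim: q n => [//|q IH] n /=; rewrite (eq_dshift IH) /dshift sumrB -mulr_sumr.
by case: n => [|n] //=; rewrite big1_eq.
Qed.

Lemma iter_dshift_shift q (a : nat -> K) n :
  iter q dshift (shift a) n = shift (iter q dshift a) n.
Proof.
elim: q n => [//|q IH] n /=; rewrite (eq_dshift IH) /dshift.
by case: n => [|n] //=; rewrite mulr0 subr0.
Qed.

End Shift.

Section LinForms.
Variables (K : comNzRingType) (I : finType).
Implicit Types (l : seq (I -> K)) (g : {ffun I -> int}) (t : seq I).

Definition unitv (i : I) : {ffun I -> int} := [ffun j => (i == j)%:Z].

Definition content t : {ffun I -> int} := [ffun i => (count_mem i t)%:Z].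

Lemma content_nil : content [::] = 0.
Proof. by apply/ffunP => i; rewrite !ffunE. Qed.

Lemma content_cons i t : content (i :: t) = unitv i + content t.
Proof. by apply/ffunP => j; rewrite !ffunE /= PoszD. Qed.

Lemma content_perm t t' : perm_eq t t' -> content t = content t'.
Proof.
by move=> /seq.permP tt'; apply/ffunP => i; rewrite !ffunE (tt' (pred1 i)).
Qed.

Lemma content_eq t t' : (content t == content t') = perm_eq t t'.
Proof.
apply/eqP/idP => [E|]; last exact: content_perm.
apply/allP => i _; move/ffunP/(_ i): E; rewrite !ffunE => -[E] /=.
by rewrite E.
Qed.

(* The coefficient of x^g in the product of the linear forms
   \sum_i rho_i x_i, for rho in l. *)
Fixpoint coefprod l g : K :=
  if l is rho :: l' then \sum_x rho x * coefprod l' (g - unitv x)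
  else (g == 0)%:R.

Lemma coefprod_cons rho l g :
  coefprod (rho :: l) g = \sum_x rho x * coefprod l (g - unitv x).
Proof. by []. Qed.

Lemma coefprod_lt0 l g i : g i < 0 -> coefprod l g = 0.
Proof.
elim: l g => [|a l IH] g gi /=.
  by case: eqP => // g0; rewrite g0 ffunE ltxx in gi.
rewrite big1 // => x _; rewrite IH ?mulr0 // !ffunE.
by apply: le_lt_trans gi; rewrite gerBl; case: eqP.
Qed.

Lemma coefprod_swap l1 rho l2 g :
  coefprod (l1 ++ rho :: l2) g = coefprod (rho :: l1 ++ l2) g.
Proof.
elim: l1 g => [//|a l1 IH] g.
rewrite cat_cons; rewrite [LHS]/=.
under eq_bigr do rewrite IH /= mulr_sumr.
rewrite exchange_big /=; apply: eq_bigr => x _; rewrite mulr_sumr.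
by apply: eq_bigr => y _; rewrite mulrCA addrAC.
Qed.

Lemma coefprod_unit j l g :
  coefprod ((fun x => (x == j)%:R) :: l) g = coefprod l (g - unitv j).
Proof.
rewrite /= (bigD1 j) //= eqxx mul1r big1 ?addr0 // => i /negPf ->.
by rewrite mul0r.
Qed.

End LinForms.

Section Multisets.
Variables (K : comNzRingType) (r : nat).
Implicit Types (n m : nat) (u : 'I_r.+1).

Notation lev := 'I_r.+1.

Definition leL : rel lev := fun i j => (i <= j)%N.

Lemma leL_trans : transitive leL.
Proof. by move=> b a c; apply: leq_trans. Qed.

Lemma leL_total : total leL.
Proof. by move=> a b; apply: leq_total. Qed.

Lemma leL_anti : antisymmetric leL.
Proof. by move=> a b /anti_leq/val_inj. Qed.

(* Multisets of levels that are at least m, as sorted sequences. *)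
Definition multis m (l : seq lev) := sorted leL l && all (fun i : lev => m <= i)%N l.

(** Inserting one more [u] and sorting inverts the removal of a [u]. On generating functions in the
    length, this is multiplication by z. *)
Lemma sum_multis_rem n m u (G : seq lev -> K) : (m <= u)%N ->
  \sum_(t : n.+1.-tuple lev | multis m t && (u \in t)) G (rem u t) =
  \sum_(t : n.-tuple lev | multis m t) G t.
Proof.
move=> mu.
pose h (t : n.-tuple lev) : n.+1.-tuple lev := [tuple of sort leL (u :: t)].
(* The value [nseq n u] is a mere default: [h'] matters only where [u] occurs. *)
pose h' (t : n.+1.-tuple lev) : n.-tuple lev :=
  insubd [tuple of nseq n u] (rem u t).
have h'E t : u \in t -> h' t = rem u t :> seq lev.
  by move=> ut; rewrite /h' insubdK // unfold_in size_rem // size_tuple.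
rewrite (reindex_onto h h') /=; last first.
  move=> t /andP[/andP[st _] ut]; apply: val_inj; rewrite /= h'E //.
  rewrite -[RHS](sorted_sort leL_trans st); apply/perm_sortP => //.
  - exact: leL_total.
  - exact: leL_trans.
  - exact: leL_anti.
  by rewrite perm_sym perm_to_rem.
have hP (t : n.-tuple lev) : u \in h t.
  by rewrite mem_sort mem_head.
have remh (t : n.-tuple lev) : sorted leL t -> rem u (h t) = t.
  move=> st; apply: (sorted_eq leL_trans leL_anti) => //.
    apply: (subseq_sorted leL_trans (rem_subseq u _)).
    exact: (sort_sorted leL_total).
  rewrite -(perm_cons u) perm_sym; apply: perm_trans (perm_to_rem (hP t)).
  by rewrite perm_sym perm_sort.
have all_h (t : n.-tuple lev) : all (fun i : lev =>
  m <= i)%N (h t) = all (fun i : lev => m <= i)%N t.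
  by rewrite all_sort /= mu.
apply: eq_big => [t|t /andP[_ /eqP ht]]; last by rewrite -(h'E _ (hP t)) ht.
rewrite hP andbT /multis all_h (sort_sorted leL_total) /=.
case A: (all _ t) => /=; rewrite ?andbF // andbT.
  apply/eqP/idP => [<-|st]; last by apply: val_inj; rewrite /= h'E // remh.
  rewrite h'E //; apply: (subseq_sorted leL_trans (rem_subseq u _)).
  exact: (sort_sorted leL_total).
Qed.

End Multisets.

(** * Balanced systems of steps and walks *)

Lemma coefprod_map_rem (K : comNzRingType) (I : finType) (f : I -> I -> K)
    (u : I) (t : seq I) g : u \in t ->
  coefprod [seq f i | i <- t] g = coefprod (f u :: [seq f i | i <- rem u t]) g.
Proof.
move=> ut; have i_lt : (index u t < size t)%N by rewrite index_mem.
rewrite remE map_cat -coefprod_swap -[in LHS](cat_take_drop (index u t) t).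
by rewrite map_cat (drop_nth u) //= nth_index.
Qed.

Lemma content_rem (I : finType) (u : I) (t : seq I) : u \in t ->
  content t = unitv u + content (rem u t).
Proof. by move=> ut; rewrite -content_cons; apply/content_perm/perm_to_rem. Qed.

Section Walks.
Variables (K : comNzRingType) (s : K) (r : nat).
Notation lev := 'I_r.+1.
Implicit Types (n m : nat) (u v x l : lev).

Definition stepw l x : K :=
  (l <= x)%N%:R + s * (0 < x)%N%:R + s ^+ 2 * ((0 < x) && (x <= l))%N%:R.

Fixpoint walks m n u : K :=
  if n is n'.+1 then \sum_(x : lev | (m <= x)%N) stepw u x * walks m n' x else 1.

(** The degree [n] part of the coefficient sum in MacMahon's master theorem, for the matrix [stepw]
    cut down to the levels from [m] on. *)
Definition balanced m n : K :=
  \sum_(t : n.-tuple lev | multis m t) coefprod [seq stepw l | l <- t] (content t).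

(* Systems of n steps with levels at least v that are balanced up to a walker
   going from u to v. *)
Definition balwalks v u n : K :=
  \sum_(t : n.-tuple lev | multis v t)
     coefprod [seq stepw l | l <- t] (content t + unitv v - unitv u).

Lemma balwalks_diag v n : balwalks v v n = balanced v n.
Proof. by apply: eq_bigr => t _; rewrite addrK. Qed.

Lemma balwalks_lt v u n : (u < v)%N -> balwalks v u n = 0.
Proof.
move=> uv; rewrite /balwalks big1 // => t /andP[_ /allP vt].
apply: (@coefprod_lt0 _ _ _ _ u); rewrite !ffunE eqxx.
have /count_memPn -> : u \notin t by apply/negP => /vt; rewrite leqNgt uv.
by have -> : (v == u) = false by apply/eqP => vu; rewrite vu ltnn in uv.
Qed.

Lemma sum_tuple0 (R : nmodType) (P : pred (seq lev)) (F : seq lev -> R) :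
  \sum_(t : 0.-tuple lev | P t) F t = if P [::] then F [::] else 0.
Proof.
rewrite big_mkcond (big_pred1 [tuple]) // => t.
by apply/esym/eqP; rewrite [t]tuple0.
Qed.

Lemma unitv_eq (I : finType) (i j : I) : (unitv i - unitv j == 0) = (i == j).
Proof.
apply/eqP/eqP => [/ffunP/(_ i)|->]; last exact: subrr.
by rewrite !ffunE eqxx; case: (j =P i).
Qed.

(* The walker at u uses up a step out of u; at u = v it may also find none, and
   then the level v does not occur at all. *)
Lemma balwalks_rec v u n : (v <= u)%N ->
  balwalks v u n = (u == v)%:R * balanced v.+1 n +
    shift (fun n => \sum_x stepw u x * balwalks v x n) n.
Proof.
move=> vu; case: n => [|n].
  rewrite /balwalks /balanced.
  rewrite (sum_tuple0 (multis v)
    (fun t => coefprod (map stepw t) (content t + unitv v - unitv u))).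
  rewrite (sum_tuple0 (multis v.+1) (fun t => coefprod (map stepw t) (content t))).
  by rewrite /= addr0 content_nil add0r eqxx mulr1 unitv_eq eq_sym.
rewrite /balwalks (bigID (fun t : n.+1.-tuple lev => u \in t)) addrC /=.
congr (_ + _); last first.
  have [->|uv] := eqVneq u v; last first.
    rewrite mulr0n mul0r big1 // => t /andP[_ ut]; apply: (@coefprod_lt0 _ _ _ _ u).
    rewrite !ffunE eqxx eq_sym (negPf uv).
    by have /count_memPn -> : u \notin t by [].
  rewrite mulr1n mul1r; apply: eq_big => [t|t _]; last by rewrite addrK.
  rewrite /multis -andbA; congr andb; apply/andP/allP => [[/allP A B] x xt|A].
    rewrite ltn_neqAle A // andbT; apply: contraNneq B => /val_inj ->.
    by [].
  split; first by apply/allP => x /A/ltnW.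
  by apply/negP => /A; rewrite ltnn.
under [RHS]eq_bigr do rewrite mulr_sumr.
rewrite exchange_big /=.
(* Once a step from [u] to [x] is taken out, the rest is a system whose walker stands at [x]. *)
rewrite -(@sum_multis_rem _ r n v u (fun t => \sum_x stepw u x *
  coefprod [seq stepw l | l <- t] (content t + unitv v - unitv x)) vu).
apply: eq_bigr => t /andP[_ ut];
  rewrite (coefprod_map_rem _ _ ut) /= (content_rem ut).
apply: eq_bigr => x _; congr (_ * coefprod _ _).
by apply/ffunP => i; rewrite !ffunE; ring.
Qed.

Lemma balanced_top n : balanced r.+1 n = (n == 0%N)%:R.
Proof.
case: n => [|n]; rewrite /balanced.
  by rewrite (sum_tuple0 (multis r.+1) (fun t =>
    coefprod (map stepw t) (content t))) /= content_nil eqxx.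
by rewrite big1 // => t; case/tupleP: t => x t;
  rewrite /multis /= ltnNge -ltnS ltn_ord andbF.
Qed.

(* Weighted number of words with letters at least m and an initial step that
   behaves like a step from a level below all letters. *)
Definition words m n : K :=
  if n is n'.+1 then (1 + s) * \sum_(x : lev | (m <= x)%N) walks m n' x else 1.

(** The right-hand side counts the walks from [u] on levels at least [v] that visit [v]; for [u > v]
    this is a difference of two counts. [balwalks_rec] matches the first step of such a walk. *)
Lemma iter_balwalks v u n q :
  (forall n, iter q (dshift s) (balanced v.+1) n = words v.+1 n) ->
  iter q (dshift s) (balwalks v u) n =
    if (u < v)%N then 0 else if u == v then walks v n v
    else walks v n u - walks v.+1 n u.
Proof.
move=> IHv; elim: n u => [|n IH] u.
all: have [uv|vu] := ltnP u v; first
  by rewrite (eq_iter_dshift _ _ (fun k => balwalks_lt k uv)) iter_dshift0.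
all: rewrite (eq_iter_dshift _ _ (fun k => balwalks_rec k vu)) iter_dshiftD.
all: rewrite iter_dshiftZ iter_dshift_shift IHv /=.
  by rewrite addr0 mulr1; case: (u == v); rewrite // subrr.
rewrite iter_dshift_sum.
under [X in _ + X = _]eq_bigr => x _ do rewrite (@iter_dshiftZ K s q (stepw u x)
  (balwalks v x) n) IH.
have sumv (F : lev -> K) : \sum_(x : lev | (v <= x)%N) F x =
  F v + \sum_(x : lev | (v < x)%N) F x.
  rewrite (bigD1 v) //=; congr (_ + _); apply: eq_bigl => x.
  by rewrite ltn_neqAle andbC; congr andb; rewrite eq_sym.
have -> : \sum_(x : lev) stepw u x * (if (x < v)%N then 0 else if x == v
  then walks v n v else walks v n x - walks v.+1 n x) =
  \sum_(x : lev | (v <= x)%N) stepw u x * walks v n x - \sum_(x : lev |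
  (v < x)%N) stepw u x * walks v.+1 n x.
  rewrite !sumv (bigID (fun x : lev => (x < v)%N)) /= big1 ?add0r; last first.
    by move=> x ->; rewrite mulr0.
  under eq_bigl do rewrite -leqNgt.
  rewrite sumv ltnn eqxx -addrA; congr (_ + _); rewrite -sumrB.
  apply: eq_bigr => x vx; rewrite ltnNge ltnW //= -mulrBr.
  by have -> : (x == v) = false by apply/eqP => xv; rewrite xv ltnn in vx.
(* At [u = v], the term [words v.+1] restores the walks that never come back to [v], since every
   step from [v] to a higher level weighs [1 + s]. *)
case: eqVneq => [->|_]; last by rewrite mulr0n mul0r add0r.
rewrite mulr1n mul1r addrCA mulr_sumr -sumrB [X in _ + X]big1 ?addr0 // => x vx.
rewrite /stepw (ltnW vx) (leq_ltn_trans _ vx) // leqNgt vx /=; ring.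
Qed.

(** Descending induction on [m]: [iter_balwalks] with [u = v = m] yields walks from [m], and one
    further factor 1 - s^2 z deletes the loop of weight [s ^+ 2] as a first step, so that every
    first step weighs [1 + s]. *)
Lemma iter_balanced m n : (0 < m <= r.+1)%N ->
  iter (r.+1 - m) (dshift s) (balanced m) n = words m n.
Proof.
move=> /andP[m0 mr]; have [q qE] : exists q, m = (r.+1 - q)%N.
  by exists (r.+1 - m)%N; rewrite subKn.
have {mr} qr : (q <= r)%N by lia.
have -> : (r.+1 - m = q)%N by lia.
rewrite qE {m qE m0}.
elim: q qr n => [|q IH] qr n.
  rewrite subn0 /= balanced_top; case: n => [|n] //=.
  by rewrite big_pred0 ?mulr0 // => x; rewrite ltnNge -ltnS ltn_ord.
have qlt : (r - q < r.+1)%N by rewrite ltnS leq_subr.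
pose v := Ordinal qlt.
have vE : (r.+1 - q = v.+1)%N by rewrite /= subSn // ltnW.
rewrite subSS -[(r - q)%N]/(v : nat).
have {}IH k : iter q (dshift s) (balanced v.+1) k = words v.+1 k.
  by rewrite -vE; apply: IH; lia.
have E k : iter q (dshift s) (balanced v) k = walks v k v.
  rewrite -(eq_iter_dshift _ _ (balwalks_diag v)) (iter_balwalks _ _ IH).
  by rewrite ltnn eqxx.
rewrite /= (eq_dshift _ E) /dshift; case: n => [|n] /=; first by rewrite mulr0 subr0.
have v0 : (0 < v)%N by rewrite /= subn_gt0.
rewrite (bigD1 v) //= [in RHS](bigD1 v) //= mulrDr mulr_sumr.
rewrite [stepw v v]/stepw leqnn v0 /= addrAC; congr (_ + _); first by ring.
apply: eq_bigr => x /andP[vx xv];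
  rewrite /stepw vx (leq_trans v0 vx) leqNgt ltn_neqAle eq_sym.
rewrite xv vx /=; ring.
Qed.

(** Level 0 has no loop of weight [s ^+ 2], so no factor is spent on it. *)
Lemma iter_balanced0 n : iter r (dshift s) (balanced 0) n = walks 0 n ord0.
Proof.
rewrite -(eq_iter_dshift _ _ (balwalks_diag ord0)) iter_balwalks ?ltnn ?eqxx //.
by move=> k; rewrite -iter_balanced ?subSS ?subn0.
Qed.

End Walks.

(** * Forbidden loops at the first cell of a level *)

Section Strict.
Variables (K : comNzRingType) (s : K) (r : nat).
Notation lev := 'I_r.+1.
Notation stepw := (@stepw K s r).
Implicit Types (n m : nat) (j l x : lev) (c : pred lev) (t : seq lev).

Definition strictw l x : K := stepw l x - s ^+ 2 * (x == l)%:R.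

(* The levels in c whose first cell has not been met yet lose their loop of
   weight s ^+ 2 at that cell. *)
Fixpoint srows c t : seq (lev -> K) :=
  if t is l :: t' then
    (if c l then strictw l else stepw l) :: srows [pred x | c x & x != l] t'
  else [::].

Lemma eq_srows c c' t : {in t, c =1 c'} -> srows c t = srows c' t.
Proof.
elim: t c c' => //= l t IH c c' cc'; rewrite cc' ?mem_head //; congr cons.
by apply: IH => x xt /=; rewrite cc' // in_cons xt orbT.
Qed.

Lemma srows0 t : srows pred0 t = map stepw t.
Proof. by elim: t => //= l t <-; congr cons; apply: eq_srows. Qed.

(** Only the row at the first occurrence of [j] changes: its coefficient at [j] drops by [s ^+ 2],
    and that term leaves the product of the other rows. *)
Lemma coefprod_srowsU1 c j t g : ~~ c j -> j \in t ->
  coefprod (srows (predU1 j c) t) g =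
  coefprod (srows c t) g - s ^+ 2 * coefprod (srows c (rem j t)) (g - unitv j).
Proof.
move=> + jt; elim: t jt c g => //= l t IH jt c g cj.
have [->|lj] := eqVneq l j.
  rewrite (@eq_srows _ c) => [|x xt /=]; last first.
    by rewrite /predU1 /=; case: eqVneq => [->|]; rewrite ?(negPf cj) ?andbT.
  rewrite (@eq_srows [pred x | c x & x != j] c) => [|x xt /=]; last first.
    by case: eqVneq => [->|]; rewrite ?(negPf cj) ?andbT.
  rewrite (negPf cj) /= -coefprod_unit coefprod_cons mulr_sumr -sumrB.
  by apply: eq_bigr => x _; rewrite /strictw; ring.
rewrite in_cons eq_sym (negPf lj) /= in jt.
rewrite /= mulr_sumr -sumrB; apply: eq_bigr => x _.
rewrite (@eq_srows _ (predU1 j [pred x | c x & x != l])) => [|y yt /=]; last first.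
  by rewrite /predU1 /=; case: (eqVneq y j) => [->|]; rewrite //= eq_sym lj.
rewrite IH //= ?(negPf cj) // addrAC; ring.
Qed.

Definition strictsum c m n : K :=
  \sum_(t : n.-tuple lev | multis m t) coefprod (srows c t) (content t).

Lemma strictsumU1 c j m n : ~~ c j -> (m <= j)%N ->
  strictsum (predU1 j c) m n = dshift s (strictsum c m) n.
Proof.
move=> cj mj; rewrite /dshift.
case: n => [|n].
  rewrite /= mulr0 subr0; apply: eq_bigr => t _; rewrite [t]tuple0 //.
have /= -> : shift (strictsum c m) n.+1 = _ :=
  esym (@sum_multis_rem _ r n m j (fun t => coefprod (srows c t) (content t)) mj).
rewrite /strictsum (bigID (fun t : n.+1.-tuple lev => j \in t)) /=.
rewrite [\sum_(t : n.+1.-tuple lev |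
  multis m t) _](bigID (fun t : n.+1.-tuple lev => j \in t)) /=.
rewrite mulr_sumr addrAC -sumrB; congr (_ + _); apply: eq_bigr => t /andP[_ jt].
  rewrite coefprod_srowsU1 // (content_rem jt); congr (_ - _ * coefprod _ _).
  by rewrite addrAC subrr add0r.
congr coefprod; apply: eq_srows => x xt; rewrite /predU1 /=.
by case: eqVneq => // xj; rewrite xj (negPf jt) in xt.
Qed.

Lemma eq_strictsum c c' m n : c =1 c' -> strictsum c m n = strictsum c' m n.
Proof. by move=> cc'; apply: eq_bigr => t _; congr coefprod; apply: eq_srows. Qed.

(** The levels 1, ..., [r] are made strict one after the other, each for one factor 1 - s^2 z. *)
Lemma strictsumE m n : (m <= 1)%N ->
  strictsum [pred x : lev | 0 < x]%N m n = iter r (dshift s) (balanced s r m) n.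
Proof.
move=> m1.
have H q : (q <= r)%N -> forall n,
  strictsum [pred x : lev | 0 < x <= q]%N m n = iter q (dshift s) (balanced s r m) n.
  elim: q => [|q IH] qr {}n.
    rewrite (@eq_strictsum _ pred0); last by case=> [[|x]].
    by apply: eq_bigr => t _; rewrite srows0.
  have jlt : (q.+1 < r.+1)%N by [].
  rewrite /= -(eq_dshift _ (IH (ltnW qr))).
  rewrite -(@strictsumU1 _ (Ordinal jlt)) /= ?ltnn ?(leq_trans m1) //.
  apply: eq_strictsum => x; rewrite /predU1 /= -val_eqE /=.
  by case: x => [x xr] /=; lia.
rewrite -H //; apply: eq_strictsum => x /=; rewrite -ltnS.
by case: x => x xr /=; lia.
Qed.

Lemma strictsum0 n : strictsum [pred x : lev | 0 < x]%N 0 n =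
  walks s 0 n (ord0 : lev).
Proof. by rewrite strictsumE // iter_balanced0. Qed.

Lemma strictsum1 n : strictsum [pred x : lev | 0 < x]%N 1 n = words s r 1 n.
Proof. by rewrite strictsumE // -iter_balanced ?subSS ?subn0. Qed.

End Strict.

(** * Words and their levels *)

Lemma big_tupleS (R : Type) (idx : R) (op : Monoid.com_law idx) (T : finType) n
    (F : seq T -> R) :
  \big[op/idx]_(a : n.+1.-tuple T) F a =
  \big[op/idx]_(x : T) \big[op/idx]_(a : n.-tuple T) F (x :: a).
Proof.
rewrite pair_bigA /=.
pose h (p : T * n.-tuple T) : n.+1.-tuple T := [tuple of p.1 :: p.2].
rewrite (reindex h) //=; exists (fun t => (thead t, [tuple of behead t])).
  by move=> [x a] _; rewrite /h /= theadE; congr pair; apply: val_inj.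
by move=> t _; apply: val_inj; rewrite /= [t in RHS]tuple_eta.
Qed.

Section Letters.
Variables (K : comNzRingType) (s : K) (r : nat).
Notation lev := 'I_r.+1.
Notation letter := ('I_r.+1 * bool)%type.
Implicit Types (l x : lev) (c : pred lev) (t : seq lev) (a : letter).

(* The letter (c, b) stands for the integer c, or - c when b = true. *)
(* Level entered by a letter read at level l: |a|, or |a| + 1 at an excedance. *)
Definition tgt l a : lev := if a.2 || (l <= a.1)%N then a.1 else inord a.1.+1.

Definition lwt l a : K := if a.2 then s else if (l <= a.1)%N then 1 else s ^+ 2.

(* When b holds, the loop of weight s ^+ 2 from l to l is excluded. *)
Definition ok (b : bool) l a :=
  ~~ (a.2 && (a.1 == 0%N :> nat)) && ~~ [&& b, ~~ a.2 & a.1.+1 == l].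

(** The letters leading from [l] to [x] are [(x, false)] if [l <= x], [(x, true)] if [0 < x], and
    [(x - 1, false)] if [0 < x <= l], of weights 1, [s] and [s ^+ 2]. The last one is forbidden by
    [b] when [x = l]. *)
Lemma sum_lwt (b : bool) l x : (b -> 0 < l)%N ->
  \sum_(a | ok b l a && (tgt l a == x)) lwt l a =
  (if b then strictw s l else stepw s l) x.
Proof.
move=> b0; rewrite big_mkcond /=.
rewrite -(pair_bigA _ (fun (c : lev) (d : bool) =>
  if ok b l (c, d) && (tgt l (c, d) == x) then lwt l (c, d) else 0)) /=.
under eq_bigr do rewrite big_bool.
rewrite big_split /= /ok /tgt /lwt /=.
have -> : \sum_(c : lev) (if ~~ (c == 0%N :> nat) && ~~ (b && false) &&
  (c == x) then s else 0) = s * (0 < x)%N%:R.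
  rewrite (bigD1 x) //= eqxx andbF andbT big1 ?addr0; last first.
    by move=> i /negPf ->; rewrite andbF.
  by rewrite lt0n; case: eqP => _; rewrite /= ?mulr1 ?mulr0.
rewrite (bigID (fun c : lev => l <= c)%N) /=.
have -> : \sum_(i : lev | (l <= i)%N)
   (if ~~ (b && (i.+1 == l)) && ((if (l <= i)%N then i else inord i.+1) == x)
    then if (l <= i)%N then 1 else s ^+ 2
    else 0) = (l <= x)%N%:R.
  have E (i : lev) : (l <= i)%N ->
   (if ~~ (b && (i.+1 == l)) && ((if (l <= i)%N then i else inord i.+1) == x)
    then if (l <= i)%N then 1 else s ^+ 2
    else 0) = (if i == x then 1 else 0) :> K.
    move=> li; rewrite li; have -> : (i.+1 == l) = false by lia.
    by rewrite andbF.
  rewrite (eq_bigr _ E); case: leqP => lx.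
    rewrite (bigD1 x) //= eqxx big1 ?addr0 // => i /andP[_ /negPf ->] //.
  by rewrite big1 // => i li; case: eqP => // ix; rewrite -ix ltnNge li in lx.
have E (i : lev) : ~~ (l <= i)%N ->
   (if ~~ (b && (i.+1 == l)) && ((if (l <= i)%N then i else inord i.+1) == x)
    then if (l <= i)%N then 1 else s ^+ 2
    else 0) = (if ~~ (b && (x == l)) && (i.+1 == x) then s ^+ 2 else 0) :> K.
  move=> li; rewrite (negPf li).
  have -> : (inord i.+1 == x) = (i.+1 == x).
    by rewrite -val_eqE /= inordK //; case: l li {b0} => l lr /=; lia.
  by case: (i.+1 =P x) => ix; rewrite ?andbF // ix.
rewrite (eq_bigr _ E) {E} -big_mkcondr /=.
have [x0|x0] := posnP x.
  rewrite big_pred0 => [|i]; last by rewrite x0 !andbF.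
  rewrite !mulr0n mulr0 addr0 add0r.
  case: b b0 => b0; rewrite /strictw /stepw x0 /= !mulr0n !mulr0 !addr0 //.
  have -> : (x == l) = false by apply/eqP => xl; move: b0; rewrite -xl x0 => /(_ isT).
  by rewrite mulr0n mulr0 subr0.
have xr : (x.-1 < r.+1)%N by case: x x0 => x xr /=; lia.
rewrite (eq_bigl (fun i : lev => (~~ (b && (x == l)) && (x <= l)%N) &&
  (i == Ordinal xr))); last first.
  move=> i; rewrite -[i == _]val_eqE /= -ltnNge.
  have -> : (i == x.-1 :> nat) = (i.+1 == x) by lia.
  case: (i.+1 =P x) => [->|]; last by rewrite !andbF.
  by rewrite !andbT andbC.
rewrite big_mkcondl /=.
rewrite (big_pred1 (Ordinal xr)) //.
case: b {b0}; rewrite /strictw /stepw x0 /=; last first.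
  by case: (x <= l)%N; rewrite ?mulr1n ?mulr0n; ring.
have [->|xl] := eqVneq x l; rewrite ?leqnn /=; first by rewrite !mulr1n; ring.
by case: (x <= l)%N; rewrite ?mulr1n !mulr0n; ring.
Qed.

Fixpoint okseq c t (w : seq letter) : bool :=
  match t, w with
  | l :: t', a :: w' => ok (c l) l a && okseq [pred x | c x & x != l] t' w'
  | _, _ => true
  end.

Definition tgts t (w : seq letter) := [seq tgt p.1 p.2 | p <- zip t w].

Definition weight t (w : seq letter) : K := \prod_(p <- zip t w) lwt p.1 p.2.

Lemma tgts_cons l t a (w : seq letter) :
  tgts (l :: t) (a :: w) = tgt l a :: tgts t w.
Proof. by []. Qed.

Lemma weight_cons l t a (w : seq letter) :
  weight (l :: t) (a :: w) = lwt l a * weight t w.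
Proof. by rewrite /weight big_cons. Qed.

Lemma okseq_cons c l t a (w : seq letter) :
  okseq c (l :: t) (a :: w) = ok (c l) l a && okseq [pred x | c x & x != l] t w.
Proof. by []. Qed.

(** Expanding each row into letters by [sum_lwt] turns a choice of monomials into a word whose
    targets record the exponents. *)
Lemma coefprod_srows n c t g : {subset c <= [pred l : lev | 0 < l]%N} ->
  size t = n ->
  coefprod (srows s c t) g =
  \sum_(w : n.-tuple letter | okseq c t w && (content (tgts t w) == g)) weight t w.
Proof.
elim: n c t g => [|n IH] c [|l t] g // c0 => [_|[szt]].
  rewrite big_mkcond (big_pred1 [tuple]) => [|w]; last first.
    by apply/esym/eqP; rewrite [w]tuple0.
  by rewrite /= content_nil /weight /= big_nil eq_sym; case: eqP.
rewrite [RHS]big_mkcond /= (big_tupleS _ n (fun w =>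
  if okseq c (l :: t) w && (content (tgts (l :: t) w) == g)
  then weight (l :: t) w else 0)).
have b0 : (c l -> 0 < l)%N by apply: c0.
pose G x := coefprod (srows s [pred x | c x & x != l] t) (g - unitv x).
rewrite (eq_bigr (fun a => if ok (c l) l a then lwt l a * G (tgt l a) else 0));
  last first.
  move=> a _; rewrite /G (IH [pred x | c x & x != l]) //; last first.
    by move=> x; rewrite inE => /andP[/c0].
  case E: (ok _ _ _); last by rewrite big1 // => w _; rewrite okseq_cons E.
  rewrite mulr_sumr [RHS]big_mkcond; apply: eq_bigr => w _.
  rewrite okseq_cons E tgts_cons weight_cons /=.
  rewrite content_cons [unitv _ + _]addrC -[_ + _ == g]subr_eq0 -addrA -opprB
    subr_eq0.
  by case: ifP.
rewrite -big_mkcond (partition_big (tgt l) predT) //=.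
apply: eq_bigr => x _; rewrite -/(G x) -(sum_lwt x b0) mulr_suml.
by apply: eq_bigr => a /andP[_ /eqP ->].
Qed.

(** The shrinking of [c] along [t] amounts to testing whether cell [j] is the first one of its
    level. *)
Lemma okseqP c t (w : seq letter) (l0 : lev) (a0 : letter) : size t = size w ->
  reflect (forall j, (j < size t)%N ->
     ok (c (nth l0 t j) && (nth l0 t j \notin take j t)) (nth l0 t j) (nth a0 w j))
  (okseq c t w).
Proof.
elim: t w c => [|l t IH] [|a w] c //= => [_|[sz]]; first by constructor.
apply: (iffP andP) => [[okl /IH -/(_ sz) okt] [|j] jt /=|H].
- by rewrite andbT.
- by have := okt j jt; rewrite /= in_cons negb_or andbA.
split; first by have := H 0%N isT; rewrite /= andbT.
apply/IH => // j jt; have := H j.+1 jt; rewrite /= in_cons negb_or andbA.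
by [].
Qed.

Definition valid t (w : seq letter) :=
  okseq [pred l : lev | 0 < l]%N t w && perm_eq (tgts t w) t.

Lemma strictsum_valid m n :
  strictsum s [pred l : lev | 0 < l]%N m n =
  \sum_(w : n.-tuple letter) \sum_(t : n.-tuple lev | multis m t &&
    valid t w) weight t w.
Proof.
rewrite (exchange_big_dep (fun t : n.-tuple lev => multis m t)) /=;
  last by move=> w t _ /andP[].
apply: eq_bigr => t mt; rewrite (coefprod_srows _ _ (size_tuple t)) //.
by apply: eq_bigl => w; rewrite mt /= /valid content_eq.
Qed.

End Letters.

(** * Uniqueness of the levels of a word *)

Section Valid.
Variable (r : nat).
Notation lev := 'I_r.+1.
Notation letter := ('I_r.+1 * bool)%type.

Lemma multis0P n (t : n.-tuple lev) :
  reflect (forall i j : 'I_n, i <= j -> tnth t i <= tnth t j)%N (multis 0 t).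
Proof.
have -> : multis 0 t = sorted (@leL r) t.
  by rewrite /multis (@eq_all _ _ predT) // all_predT andbT.
apply: (iffP idP) => [st i j ij|H].
  rewrite !(tnth_nth ord0).
  have refl : reflexive (@leL r) by move=> x; apply: leqnn.
  by apply: (sorted_leq_nth (@leL_trans r) refl ord0 st); rewrite ?inE ?size_tuple.
case: n t H => [|n] t H; first by rewrite [t]tuple0.
apply/(sortedP ord0) => i; rewrite size_tuple => ilt.
have := H (Ordinal (ltnW ilt)) (Ordinal ilt) (leqnSn _).
by rewrite !(tnth_nth ord0).
Qed.

Lemma tgtsE n (t : n.-tuple lev) (w : n.-tuple letter) :
  tgts t w = [seq tgt (tnth t j) (tnth w j) | j <- enum 'I_n].
Proof.
rewrite /tgts -[in LHS](map_tnth_enum t) -[in LHS](map_tnth_enum w).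
by rewrite zip_map -map_comp.
Qed.

Lemma validP n (t : n.-tuple lev) (w : n.-tuple letter) :
  reflect [/\ forall j, ~~ ((tnth w j).2 && ((tnth w j).1 == 0%N :> nat)),
     forall j : 'I_n, (forall i : 'I_n, i < j -> tnth t i != tnth t j)%N ->
       ~~ (tnth w j).2 -> (tnth w j).1.+1 != tnth t j &
     perm_eq [seq tgt (tnth t j) (tnth w j) | j <- enum 'I_n] t]
   (valid t w).
Proof.
case: n t w => [|n] t w.
  rewrite [t]tuple0 [w]tuple0; apply: (iffP idP) => // _.
  by split=> [[] //|[] //|]; rewrite enum_ord0.
rewrite /valid -tgtsE.
have sz : size t = size w by rewrite !size_tuple.
apply: (iffP andP) => [[/(okseqP _ ord0 (ord0, false) sz) H pe]|[H1 H2 pe]].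
  rewrite size_tuple in H; split=> // j; have := H j (ltn_ord j).
    by rewrite -!tnth_nth => /andP[].
  rewrite -!tnth_nth => /andP[_ H2] fst nb; move: H2; rewrite nb /=.
  have [E|//] := eqVneq (tnth w j).1.+1 (nat_of_ord (tnth t j)).
  rewrite -E /= andbT negbK => /(nthP ord0)[i].
  rewrite size_take size_tuple ltn_ord => ij.
  rewrite nth_take // => ti; have in1 := ltn_trans ij (ltn_ord j).
  by have := fst (Ordinal in1) ij; rewrite (tnth_nth ord0) /= ti eqxx.
split=> //; apply/(okseqP _ ord0 (ord0, false) sz) => j; rewrite size_tuple => jn.
have := H1 (Ordinal jn); have := H2 (Ordinal jn).
rewrite !(tnth_nth ord0) !(tnth_nth (ord0, false)) /= => {}H2 {}H1.
rewrite /ok H1 /=; apply/negP => /and3P[/andP[_ nin] nb /eqP E].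
suff: (nth (ord0, false) w j).1.+1 != nth ord0 t j by rewrite E eqxx.
apply: H2 => // i ij; rewrite (tnth_nth ord0); apply: contraNneq nin => <-.
rewrite -(nth_take ord0 ij); apply: mem_nth.
by rewrite size_take size_tuple jn.
Qed.

Lemma tgt_le (l : lev) (a : letter) (x : nat) :
  (tgt l a <= x)%N = (a.1 <= x)%N && ~~ ((a == (a.1,
    false)) && (a.1 == x :> nat) && (x < l)%N).
Proof.
case: a => a b; rewrite /tgt /= xpair_eqE eqxx /=.
case: b => /=; first by rewrite andbT.
have := ltn_ord l; case: (leqP l a) => la lr /=; last rewrite inordK; lia.
Qed.

(** The levels are the targets up to order, and the targets at most [x] come from the letters at
    most [x], except for the excedances with letter [x], which go to [x + 1]. *)
Lemma valid_card_le n (t : n.-tuple lev) (w : n.-tuple letter) (x : nat) :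
  valid t w ->
  (#|[set j | tnth t j <= x]| +
     #|[set j | (tnth w j == ((tnth w j).1,
       false)) && ((tnth w j).1 == x :> nat) && (x < tnth t j)]|
  = #|[set j | (tnth w j).1 <= x]|)%N.
Proof.
move=> /validP[_ _ /seq.permP/(_ (fun l : lev => l <= x)%N)].
move=> H.
have cE (P : pred 'I_n) : count P (enum 'I_n) = #|[set j | P j]|.
  by rewrite cardE {2}/enum_mem size_filter -enumT; apply: eq_count => j;
    rewrite /= inE.
have {H} <- : #|[set j | (tgt (tnth t j) (tnth w j) <= x)%N]| =
  #|[set j | (tnth t j <= x)%N]|.
  rewrite -!cE -[RHS](count_map (tnth t) (fun l : lev => l <= x)%N).
  rewrite map_tnth_enum -H.
  exact: esym (count_map (fun j => tgt (tnth t j) (tnth w j)) (fun l : lev =>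
    l <= x)%N _).
rewrite -cardsUI.
rewrite [X in (_ + X)%N]eq_card0 ?addn0 => [|j]; last first.
  rewrite !inE /= tgt_le; apply/negP => /andP[/andP[_ /negP H] H']; exact: H.
apply: eq_card => j; rewrite !inE /= tgt_le.
case E: ((_ == (_, false)) && _ && _) => /=; rewrite ?andbT ?orbF ?andbF //=.
by case/andP: E => /andP[_ /eqP ->] _; rewrite leqnn.
Qed.

(* For a sorted valid t, the cells of level > x that carry the letter x are
   determined by their number; if t' put more of them above x than t does, the
   first such cell would be a forbidden loop at level x + 1. *)
Lemma valid_le n (t t' : n.-tuple lev) (w : n.-tuple letter) :
  multis 0 t -> multis 0 t' -> valid t w -> valid t' w ->
  forall j, (tnth t' j <= tnth t j)%N.
Proof.
move=> /multis0P mt /multis0P mt' vt vt' j; rewrite leqNgt; apply/negP => tt'.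
set x := nat_of_ord (tnth t j) in tt'.
have C := valid_card_le x vt; have C' := valid_card_le x vt'.
pose A := [set j | (tnth t j <= x)%N]; pose A' := [set j | (tnth t' j <= x)%N].
pose B := [set j | (tnth w j == ((tnth w j).1, false)) && ((tnth w j).1 == x :> nat)].
have sA : A' \subset A.
  apply/fintype.subsetP => i; rewrite !inE => ti; apply: mt.
  by rewrite leqNgt; apply/negP => /ltnW/mt'; rewrite leqNgt (leq_ltn_trans ti).
have BE (u : n.-tuple lev) : [set j | (tnth w j == ((tnth w j).1,
  false)) && ((tnth w j).1 == x :> nat) && (x < tnth u j)%N] =
  B :\: [set j | (tnth u j <= x)%N].
  by apply/setP => i; rewrite !inE -ltnNge andbC.
rewrite !BE -/A -/A' in C C'; rewrite -C in C'.
(* Both counts give the same number of letters at most [x], so [A :\: A'] has as many elements as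
   its part in [B]. *)
have sAB : A :\: A' \subset B.
  have cD : #|A :\: A'| = #|B :&: (A :\: A')|.
    have h1 := cardsID A' A; rewrite (finset.setIidPr sA) in h1.
    have h2 := cardsID A (B :\: A').
    have h3 : (B :\: A') :\: A = B :\: A.
      by rewrite finset.setDDl (finset.setUidPr sA).
    have h4 : (B :\: A') :&: A = B :&: (A :\: A') by rewrite finset.setIDAC
      finset.setIDA.
    rewrite h3 h4 in h2; lia.
  by apply/finset.setIidPr/eqP; rewrite eqEcard finset.subsetIr cD leqnn.
case: (@arg_minnP _ j (fun i => x < tnth t' i)%N (fun i => nat_of_ord i) tt') =>
  j0 xj0 j0min.
have j0A : j0 \in A :\: A'.
  rewrite !inE -ltnNge xj0 /=; exact/mt/j0min.
have := fintype.subsetP sAB _ j0A; rewrite inE => /andP[/eqP wj0 /eqP wx].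
have nb : ~~ (tnth w j0).2 by rewrite wj0.
case/validP: vt' => _ H2 /perm_mem pe.
have := pe (tgt (tnth t' j0) (tnth w j0));
  rewrite (map_f (fun j => tgt (tnth t' j) (tnth w j))) ?mem_enum // =>
  /esym/tnthP[j1 tj1].
have tE : nat_of_ord (tgt (tnth t' j0) (tnth w j0)) = x.+1.
  rewrite /tgt (negPf nb) /= leqNgt wx xj0 /= inordK //.
  by have := ltn_ord (tnth t' j0); lia.
have xj1 : tnth t' j1 = x.+1 :> nat by rewrite -tj1.
(* The target [x + 1] of [j0] is a level of [t'], so the first level of [t'] above [x] cannot exceed
   it. *)
have tj0 : tnth t' j0 = x.+1 :> nat.
  apply/eqP; rewrite eqn_leq xj0 andbT -xj1; apply: mt'.
  by apply: j0min; rewrite xj1.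
have := H2 j0 _ nb; rewrite wx tj0 eqxx => H; suff: false by []; apply: H => i ij.
rewrite -val_eqE /= tj0 neq_ltn; apply/orP; left.
by rewrite ltnS leqNgt; apply/negP => /j0min; rewrite leqNgt ij.
Qed.

Lemma valid_uniq n (t t' : n.-tuple lev) (w : n.-tuple letter) :
  multis 0 t -> multis 0 t' -> valid t w -> valid t' w -> t = t'.
Proof.
move=> mt mt' vt vt'; apply: eq_from_tnth => j; apply: val_inj; apply/eqP.
by rewrite eqn_leq !(@valid_le n _ _ w).
Qed.

End Valid.

(** * The first letter and its sign *)

Section FirstCell.
Variables (r : nat).
Notation lev := 'I_r.+1.
Notation letter := ('I_r.+1 * bool)%type.

(** The target of the first cell is a level, hence at least the lowest level [tnth t ord0]. A
    smaller letter could reach it only through the loop, which is forbidden at a first cell. *)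
Lemma valid_head_le n (t : n.+1.-tuple lev) (w : n.+1.-tuple letter) :
  multis 0 t -> valid t w -> (tnth t ord0 <= (tnth w ord0).1)%N.
Proof.
move=> /multis0P mt /validP[_ H2 /perm_mem pe].
have := pe (tgt (tnth t ord0) (tnth w ord0)).
rewrite (map_f (fun j => tgt (tnth t j) (tnth w j))) ?mem_enum // =>
  /esym/tnthP[j1 tj1].
have := mt ord0 j1 (leq0n _); rewrite -tj1 /tgt.
case: (leqP (tnth t ord0) (tnth w ord0).1) => [//|lt]; rewrite orbF.
have := H2 ord0; case: (tnth w ord0) lt => c [] /= lt H2'; first by rewrite leqNgt lt.
rewrite inordK; last by have := ltn_ord (tnth t ord0); lia.
by have /= := H2' (fun i => ltac:(by [])) isT; lia.
Qed.

(** In [valid_card_le] at 0, the cells subtracted are all the letters 0 at positive levels; hence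
    every cell of level 0 carries the letter 0. *)
Lemma valid_head0 n (t : n.+1.-tuple lev) (w : n.+1.-tuple letter) :
  multis 0 t -> valid t w ->
  (tnth t ord0 == 0%N :> nat) = ((tnth w ord0).1 == 0%N :> nat).
Proof.
move=> mt vt; apply/eqP/eqP => [t0|w0]; last first.
  by have := valid_head_le mt vt; rewrite w0; lia.
have C := valid_card_le 0 vt; case/validP: vt => H1 _ _.
pose A := [set j | tnth t j <= 0]%N.
pose W := [set j | (tnth w j).1 <= 0]%N.
have E : [set j | (tnth w j == ((tnth w j).1,
  false)) && ((tnth w j).1 == 0%N :> nat) && (0 < tnth t j)%N] = W :\: A.
  apply/setP => j; rewrite !inE -ltnNge andbC leqn0; congr andb.
  by have := H1 j; case: (tnth w j) => c [] /=;
    rewrite ?eqxx ?xpair_eqE ?andbF ?andbT // => /negPf ->.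
rewrite E -/A -/W -(cardsID A W) in C.
have AW : A \subset W.
  apply/finset.setIidPr/eqP; rewrite eqEcard finset.subsetIr.
  by move/addIn: C => <-; rewrite leqnn.
have := fintype.subsetP AW ord0; rewrite !inE t0 => /(_ isT).
by rewrite leqn0 => /eqP.
Qed.

(** By [valid_head_le] the first cell is no excedance, so both signs of its letter lead to the same
    level. *)
Lemma valid_flip n (t : n.+1.-tuple lev) (w : n.-tuple letter) (c : lev) b : (0 <
  c)%N ->
  multis 0 t -> valid t ((c, b) :: w) -> valid t ((c, ~~ b) :: w).
Proof.
move=> c0 mt vt; have := valid_head_le mt (vt : valid t [tuple of (c, b) :: w]).
rewrite !(tnth_nth ord0, tnth_nth (ord0, false)).
case/tupleP: t mt vt => l t mt;
  rewrite /valid !okseq_cons !tgts_cons /= => /andP[/andP[_ ->]].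
move=> pe lc; have E d : tgt l (c, d) = c by rewrite /tgt /= lc orbT.
rewrite E in pe; rewrite E pe /ok /= eqn0Ngt c0 andbF !andbT /=.
have -> : (c.+1 == l) = false by lia.
by rewrite !andbF.
Qed.

End FirstCell.

Lemma big_pair_bool (R : nmodType) (T : finType) (F : T * bool -> R) :
  \sum_a F a = \sum_c (F (c, true) + F (c, false)).
Proof.
rewrite (eq_bigr (fun a : T * bool => F (a.1, a.2))); last by case.
rewrite -(pair_bigA _ (fun c d => F (c, d))) /=.
by apply: eq_bigr => c _; rewrite big_bool.
Qed.

Section WordWeight.
Variables (K : comNzRingType) (s : K) (r : nat).
Notation lev := 'I_r.+1.
Notation letter := ('I_r.+1 * bool)%type.

(* By valid_uniq the sum has at most one term. *)
Definition wordw n (w : seq letter) : K :=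
  \sum_(t : n.-tuple lev | multis 0 t && valid t w) weight s t w.

Lemma wordw_neg n (w : n.-tuple letter) (c : lev) : (0 < c)%N ->
  wordw n.+1 ((c, true) :: w) = s * wordw n.+1 ((c, false) :: w).
Proof.
move=> c0; rewrite /wordw mulr_sumr; apply: eq_big => [t|t /andP[mt vt]].
  case mt : (multis 0 t) => //=.
  by apply/idP/idP => vt; [exact: (valid_flip c0 mt vt)|exact: (valid_flip c0 mt vt)].
have := valid_head_le mt (vt : valid t [tuple of (c, true) :: w]).
rewrite !(tnth_nth ord0, tnth_nth (ord0, false)).
case/tupleP: t {mt vt} => l t; rewrite !weight_cons /lwt /= => ->.
by rewrite mul1r.
Qed.

Lemma wordw_neg0 n (w : n.-tuple letter) : wordw n.+1 ((ord0, true) :: w) = 0.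
Proof.
rewrite /wordw big_pred0 // => t; apply/negP => /andP[_].
by move=> /(@validP _ _ t [tuple of (ord0, true) :: w])[/(_ ord0)].
Qed.

(** No step of nonzero weight leads from a positive level to level 0. *)
Lemma walks_pos n (x : lev) : (0 < x)%N -> walks s 0 n x = walks s 1 n x.
Proof.
elim: n x => //= n IH x x0; rewrite (bigID (fun y : lev => 0 < y)%N) /= addrC.
rewrite big1 ?add0r => [|y y0]; last first.
  by rewrite /stepw; case: y y0 => [[|y] yr] //= _;
    rewrite leqNgt x0 /= mulr0n !mulr0 !addr0 mul0r.
by apply: eq_bigr => y y0; rewrite IH.
Qed.

Lemma multis1E n (t : n.+1.-tuple lev) : multis 1 t =
  multis 0 t && (0 < tnth t ord0)%N.
Proof.
apply/idP/andP => [/andP[st al]|[mt t0]].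
  split; last by have /allP := al; apply; exact: mem_tnth.
  rewrite /multis st /=; exact/allP.
case/andP: (mt) => st _; rewrite /multis st; apply/allP => x /tnthP[i ->].
by apply: leq_trans t0 _; move/multis0P: mt; apply.
Qed.

(** Words are grouped by first letter. [strictsum1] handles nonzero first letters, up to the factor
    [1 + s] for the two signs, which is cancelled; [strictsum0] then settles the first letter 0. *)
Lemma sum_wordw n : GRing.lreg (1 + s) ->
  \sum_(w : n.+1.-tuple letter | ~~ (thead w).2) wordw n.+1 w =
  \sum_(x : lev) walks s 0 n x.
Proof.
move=> s1.
pose S (a : letter) := \sum_(w : n.-tuple letter) wordw n.+1 (a :: w).
have S0 : S (ord0, true) = 0 by apply: big1 => w _; apply: wordw_neg0.
have SN (c : lev) : (0 < c)%N -> S (c, true) = s * S (c, false).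
  by move=> c0; rewrite mulr_sumr; apply: eq_bigr => w _; apply: wordw_neg.
have sumS (P : pred letter) : \sum_(w : n.+1.-tuple letter |
  P (thead w)) wordw n.+1 w = \sum_(a | P a) S a.
  rewrite big_mkcond.
  rewrite (eq_bigr (fun w : n.+1.-tuple letter => (fun v : seq letter =>
    if P (head (ord0, false) v) then wordw n.+1 v else 0) w)); last first.
    by move=> w _; case/tupleP: w => x w; rewrite theadE.
  rewrite (big_tupleS _ n (fun v : seq letter =>
    if P (head (ord0, false) v) then wordw n.+1 v else 0)) /=.
  by rewrite [RHS]big_mkcond; apply: eq_bigr => a _; case: (P a); rewrite ?big1_eq.
have W0 := strictsum0 s r n.+1; have W1 := strictsum1 s r n.+1.
have A1 : \sum_(c : lev | (0 < c)%N) S (c,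
  false) = \sum_(x : lev | (0 < x)%N) walks s 1 n x.
  apply: s1; rewrite -[RHS]/(words s r 1 n.+1) -W1 strictsum_valid.
  (* The levels avoid 0 exactly when the first letter is nonzero, by [valid_head0]. *)
  rewrite (eq_bigr (fun w : n.+1.-tuple letter =>
    if (0 < (thead w).1)%N then wordw n.+1 w else 0)); last first.
    move=> w _; case: ifP => w0; last first.
      rewrite big_pred0 // => t; rewrite (multis1E t);
        apply/negP => /andP[/andP[mt t0] vt].
      by have := valid_head0 mt vt; rewrite eqn0Ngt t0 /= eqn0Ngt /thead in w0 *;
        rewrite w0.
    apply: eq_bigl => t; rewrite multis1E -andbA; case mt : (multis 0 t) => //=.
    case vt : (valid t w); rewrite ?andbF // andbT.
    by rewrite lt0n (valid_head0 mt vt) -lt0n.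
  rewrite -big_mkcond (sumS (fun a => 0 < a.1)%N).
  rewrite mulrDl mul1r mulr_sumr -big_split /=.
  rewrite [RHS]big_mkcond [RHS]big_pair_bool.
  rewrite [LHS]big_mkcond; apply: eq_bigr => c _ /=.
  by case: (posnP c) => [_|c0]; rewrite ?addr0 // SN // addrC.
rewrite (sumS (fun a => ~~ a.2)) big_mkcond big_pair_bool.
under eq_bigr do rewrite add0r.
have all0 (F : lev -> K) : \sum_x F x = F ord0 + \sum_(x : lev | (0 < x)%N) F x.
  by rewrite (bigD1 ord0) //=; congr (_ + _); apply: eq_bigl => x; rewrite lt0n.
rewrite !all0 A1 (eq_bigr _ (fun x x0 => walks_pos n x0)); congr (_ + _).
(* The added term stands for the nonzero first letters of either sign, so both sides become the
   totals compared by [strictsum0]. *)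
apply: (addIr ((1 + s) * \sum_(x : lev | (0 < x)%N) walks s 1 n x)).
transitivity (walks s 0 n.+1 (ord0 : lev)); last first.
  rewrite /= all0; congr (_ + _);
    first by rewrite /stepw /= mulr0n !mulr0 !addr0 mul1r.
  by rewrite mulr_sumr; apply: eq_bigr => x x0;
    rewrite walks_pos // /stepw /= x0 leqNgt x0 /= mulr0n mulr0 addr0 mulr1.
rewrite -W0 strictsum_valid -A1 -[RHS]/(\sum_(w : n.+1.-tuple letter) wordw n.+1 w).
rewrite (sumS predT) big_pair_bool.
rewrite all0 S0 add0r; congr (_ + _).
by rewrite mulr_sumr; apply: eq_bigr => c c0; rewrite SN //; ring.
Qed.

End WordWeight.

(** * Walks and integer points *)

Section Slices.
Variables (K : comNzRingType) (s : K) (r : nat).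
Notation lev := 'I_r.+1.
Notation jump := 'I_(2 * r).+1.

Definition jumpsum (d : seq jump) : nat := sumn [seq nat_of_ord e | e <- d].

(* For 0 < y, the exponent y.-1 %/ r is k - 1 for the only k such that
   (k - 1) r < y <= k r. *)
Definition slicew n (y : nat) : K :=
  \sum_(d : n.-tuple jump) s ^+ ((y + jumpsum d).-1 %/ r)%N.

Lemma slicew_shift n y : (0 < r)%N -> (0 < y)%N ->
  slicew n (y + r) = s * slicew n y.
Proof.
move=> r0 y0; rewrite mulr_sumr; apply: eq_bigr => d _; rewrite -exprS.
congr (s ^+ _); have -> : ((y + r + jumpsum d).-1 = (y + jumpsum d).-1 + r)%N by lia.
by rewrite divnDr ?dvdnn // divnn r0 addn1.
Qed.

Lemma slicewS n y : slicew n.+1 y = \sum_(e : jump) slicew n (y + e).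
Proof.
rewrite /slicew (big_tupleS _ n (fun d : seq jump =>
  s ^+ ((y + jumpsum d).-1 %/ r)%N)).
apply: eq_bigr => e _; apply: eq_bigr => d _.
by rewrite /jumpsum /= addnA.
Qed.

(** A jump from [y <= r] lands in one of the ranges y..r, r+1..2r, 2r+1..y+2r. Shifting them back by
    0, [r] and [2 * r] costs 1, [s] and [s ^+ 2], which gives the three terms of [stepw]. *)
Lemma slicew_walks n (x : lev) : slicew n x = walks s 0 n x.
Proof.
elim: n x => [|n IH] x.
  rewrite /slicew (big_pred1 [tuple]) => [|d]; last by apply/esym/eqP;
    rewrite [d]tuple0.
  (* The conventions [0.-1 = 0] and [_ %/ 0 = 0] give the exponent 0 also for [x = 0] and for
     [r = 0]. *)
  rewrite /jumpsum /= addn0; have := ltn_ord x; move: (nat_of_ord x) => y yr.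
  have [r0|r0] := posnP r; first by rewrite [X in (_ %/ X)%N]r0 divn0.
  by rewrite divn_small //; lia.
rewrite slicewS /=; under [RHS]eq_bigr do rewrite -IH /stepw.
move: (nat_of_ord x) (ltn_ord x : (x <= r)%N) => y yr.
have -> : \sum_(e : jump) slicew n (y + e) = \sum_(y <= z < r.+1) slicew n z +
    s * \sum_(1 <= z < r.+1) slicew n z + s ^+ 2 * \sum_(1 <= z < y.+1) slicew n z.
  rewrite -(big_mkord predT (fun e => slicew n (y + e))).
  have -> : \sum_(0 <= e < (2 * r).+1) slicew n (y + e) =
    \sum_(y <= z < y + (2 * r).+1) slicew n z.
    rewrite -[in RHS](add0n y) [(0 + y + _)%N]addnC.
    rewrite -[X in (_ + X)%N]add0n big_addn addnK.
    by apply: eq_bigr => e _; rewrite addnC.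
  rewrite (@big_cat_nat _ _ _ r.+1) /=; [|lia..].
  rewrite (@big_cat_nat _ _ _ (2 * r).+1 r.+1) /=; [|lia..].
  rewrite addrA; congr (_ + _ + _).
    have -> : (r.+1 = 1 + r)%N by lia.
    rewrite big_addn; have -> : ((2 * r).+1 - r = 1 + r)%N by lia.
    rewrite mulr_sumr big_nat_cond [RHS]big_nat_cond; apply: eq_bigr => z.
    by rewrite andbT => zr; rewrite slicew_shift //; lia.
  have -> : ((2 * r).+1 = 1 + (2 * r))%N by lia.
  rewrite big_addn; have -> : (y + (1 + 2 * r) - 2 * r = y.+1)%N by lia.
  rewrite mulr_sumr big_nat_cond [RHS]big_nat_cond; apply: eq_bigr => z.
  rewrite andbT => zy; rewrite mul2n -addnn addnA !slicew_shift; [|lia..].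
  by rewrite expr2 mulrA.
have low (F : nat -> K) (m : nat) :
    \sum_(m <= z < r.+1) F z = \sum_(z : lev) F z * (m <= z)%N%:R.
  rewrite big_geq_mkord big_mkcond /=; apply: eq_bigr => z _.
  by case: leqP => _; rewrite ?mulr1 ?mulr0.
have -> : \sum_(1 <= z < y.+1) slicew n z =
  \sum_(z : lev) slicew n z * (0 < z <= y)%N%:R.
  rewrite (big_nat_widen _ _ r.+1) // big_geq_mkord big_mkcond /=.
  by apply: eq_bigr => z _; rewrite ltnS andbC; case: ifP; rewrite ?mulr1 ?mulr0.
rewrite !low !mulr_sumr -!big_split /=.
apply: eq_bigr => z _; ring.
Qed.

(** The starting level of the walk serves as the first jump, whence the bound on [thead d]. *)
Lemma sum_walks n :
  \sum_(x : lev) walks s 0 n x =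
  \sum_(d : n.+1.-tuple jump | (thead d <= r)%N) s ^+ ((jumpsum d).-1 %/ r)%N.
Proof.
pose F (d : seq jump) := if (head ord0 d <= r)%N
  then s ^+ ((jumpsum d).-1 %/ r)%N else 0.
have -> : \sum_(d : n.+1.-tuple jump |
  (thead d <= r)%N) s ^+ ((jumpsum d).-1 %/ r)%N = \sum_(d : n.+1.-tuple jump) F d.
  by rewrite big_mkcond; apply: eq_bigr => d _; case/tupleP: d => e d; rewrite theadE.
rewrite (big_tupleS _ n F); under [LHS]eq_bigr do rewrite -slicew_walks.
rewrite (big_ord_widen (2 * r).+1 (fun z => slicew n z)); last by lia.
rewrite big_mkcond; apply: eq_bigr => e _; rewrite ltnS /F /=.
by case: ifP => _; rewrite ?big1_eq.
Qed.

End Slices.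

(** * Standardization of words *)

Section Standardization.
Variables (r n : nat).
Notation lev := 'I_r.+1.
Notation letter := ('I_r.+1 * bool)%type.
Implicit Types (a : n.-tuple letter) (i j : 'I_n).

(* Position of a signed index in the increasing list of the 2 n of them. *)
Definition srank (x : signed_idx n) : nat := if x.2
  then (n.-1 - x.1)%N else (n + x.1)%N.

Lemma srank_lt (x : signed_idx n) : (srank x < 2 * n)%N.
Proof. by case: x => i [] /=; rewrite /srank /=; have := ltn_ord i; lia. Qed.

Lemma ltn_srank (x y : signed_idx n) : (srank x < srank y)%N =
  (sval_int x < sval_int y).
Proof.
case: x => i [] ; case: y => j []; rewrite /srank /sval_int /=;
  have := ltn_ord i; have := ltn_ord j; lia.
Qed.

(** As [2 * n] exceeds every [srank], keys compare lexicographically: absolute value of the letter,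
    then signed position. *)
Definition wkey a j : nat := ((tnth a j).1 * (2 * n) + srank (j, (tnth a j).2))%N.

Definition sorts a (g : {perm 'I_n}) :=
  [forall i : 'I_n, forall j : 'I_n, (i < j)%N ==> (wkey a (g i) < wkey a (g j))%N].

Definition proper_word a := [forall j,
  ~~ ((tnth a j).2 && ((tnth a j).1 == 0%N :> nat))].

Lemma ltn_wkey a i j :
  (wkey a i < wkey a j)%N =
  ((tnth a i).1 < (tnth a j).1)%N ||
  ((tnth a i).1 == (tnth a j).1) && (srank (i, (tnth a i).2) < srank (j,
    (tnth a j).2))%N.
Proof.
rewrite /wkey -[_ == _ in RHS]val_eqE /=.
have xi := srank_lt (i, (tnth a i).2); have xj := srank_lt (j, (tnth a j).2).
have [ij|ji|->] /= := ltngtP (nat_of_ord (tnth a i).1) (nat_of_ord (tnth a j).1).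
- by have := leq_mul2r (2 * n) (tnth a i).1.+1 (tnth a j).1; rewrite ij orbT; lia.
- by have := leq_mul2r (2 * n) (tnth a j).1.+1 (tnth a i).1; rewrite ji orbT; lia.
by rewrite ltn_add2l.
Qed.

Section Sorted.
Variables (a : n.-tuple letter) (g : {perm 'I_n}).
Hypotheses (pa : proper_word a) (ga : sorts a g).

Let f i : nat := (tnth a (g i)).1.
Let ex i : bool := ~~ (tnth a (g i)).2 && (i < g i)%N.
Let L i : nat := (f i + ex i)%N.

(** If the absolute values agree and [i] is an excedance, the next letter is nonnegative too, and
    [j <= g i < g j] makes [j] an excedance. *)
Let L_succ i j : j = i.+1 :> nat -> (L i <= L j)%N.
Proof.
move=> ij; have := forallP (forallP ga i) j; rewrite ij ltnSn /= ltn_wkey.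
rewrite /L /ex /f => /orP[lt|/andP[/eqP E]].
  by case: (_ && _); case: (_ && _); lia.
rewrite -E leq_add2l.
case: (tnth a (g i)).2; case: (tnth a (g j)).2; rewrite /srank //=;
  have := ltn_ord (g j).
all: have := ltn_ord (g i).
all: case: (ltnP i (g i)) => //=; case: (ltnP j (g j)) => //=; lia.
Qed.

Let L_mono i j : (i <= j)%N -> (L i <= L j)%N.
Proof.
move=> ij; have [k jk] : exists k, (j = i + k :> nat)%N by exists (j - i)%N;
  rewrite subnKC.
elim: k j {ij} jk => [|k IH] j jk.
  by have -> : j = i by apply: val_inj; rewrite /= jk addn0.
have kn : (i + k < n)%N by have := ltn_ord j; lia.
have := IH (Ordinal kn) erefl; move=> /leq_trans; apply; apply: L_succ.
by rewrite /= jk addnS.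
Qed.

(** The last position is never an excedance, so its level is at most [r]. *)
Let L_le i : (L i < r.+1)%N.
Proof.
have n0 : (n.-1 < n)%N by have := ltn_ord i; lia.
apply: leq_ltn_trans (@L_mono i (Ordinal n0) _) _.
  by have := ltn_ord i; rewrite /=; lia.
rewrite /L /ex /=; have := ltn_ord (g (Ordinal n0)).
have -> : (n.-1 < g (Ordinal n0))%N = false by have := ltn_ord (g (Ordinal n0)); lia.
by rewrite andbF addn0 /f => _.
Qed.

Let t : n.-tuple lev := [tuple Ordinal (L_le i) | i < n].

Let tE i : tnth t i = L i :> nat. Proof. by rewrite tnth_mktuple. Qed.

Let L_g i : ~~ (tnth a (g i)).2 -> (L (g i) <= f i)%N = ~~ (i < g i)%N.
Proof.
move=> nb; case: (ltnP i (g i)) => ig /=.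
  apply/negP; have := L_mono (ltnW ig).
  by rewrite {1}/L {1}/ex nb ig /= addn1 => /leq_trans H /H; rewrite ltnn.
by have := L_mono ig; rewrite {2}/L /ex nb ltnNge ig /= addn0.
Qed.

Let tgt_g i : tgt (tnth t (g i)) (tnth a (g i)) = tnth t i.
Proof.
apply: ord_inj; rewrite tE /tgt tE -/(f i).
case B: (tnth a (g i)).2; first by rewrite /= /L /ex B addn0.
rewrite /= L_g ?B // /L /ex B; case: ltnP => ig /=; last by rewrite addn0.
rewrite inordK ?addn1 // -/(f i).
by have := L_le i; rewrite /L /ex B ig addn1.
Qed.

(** The unique level sequence is [L]: the cell [g i] has target [L i], and by [L_g] its weight sees
    an excedance exactly when [i < g i]. *)
Lemma wordw_sorted (K : comNzRingType) (s : K) :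
  wordw s n a = s ^+ (2 * #|[pred i | ~~ (tnth a (g i)).2 && (i < g i)%N]| +
                      #|[pred i | (tnth a (g i)).2]|).
Proof.
have mt : multis 0 t by apply/multis0P => i j ij; rewrite !tE L_mono.
have vt : valid t a.
  apply/validP; split=> [j|j fst nb|]; first exact: (forallP pa).
    (* A loop at the cell [g i] would make [i] an earlier cell of the same level. *)
    apply/negP => /eqP E; have jE : j = g ((g^-1)%g j) by rewrite permKV.
    move: (g^-1 j)%g jE => i jE; subst j.
    have := L_g nb; rewrite /f -tE -E ltnn => /esym/negbFE ig.
    have /negP[] := fst i ig; apply/eqP/ord_inj.
    by rewrite -E tE /L /ex nb ig addn1.
  have -> : tval t = [seq tgt (tnth t j) (tnth a j) | j <- [seq g i |
    i <- enum 'I_n]].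
    rewrite -map_comp -[LHS](map_tnth_enum t); apply: eq_map => i /=.
    by rewrite tgt_g.
  apply/perm_map/uniq_perm; first exact: enum_uniq.
    by rewrite map_inj_uniq ?enum_uniq //; apply: perm_inj.
  move=> j; rewrite mem_enum; apply/esym/mapP; exists (g^-1 j)%g;
    rewrite ?mem_enum //.
  by rewrite permKV.
rewrite /wordw (big_pred1 t); last first.
  move=> t'; apply/andP/eqP => [[mt' vt']|-> //].
  exact: valid_uniq mt' mt vt' vt.
have -> : weight s t a = \prod_j lwt s (tnth t j) (tnth a j).
  rewrite /weight -[in LHS](map_tnth_enum t) -[in LHS](map_tnth_enum a).
  by rewrite zip_map big_map big_enum.
rewrite (reindex g) /=; last by exists (g^-1)%g => i _; rewrite ?permK ?permKV.
have cE (P : pred 'I_n) : #|[pred i | P i]| = (\sum_i P i)%N.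
  by rewrite -sum1_card big_mkcond; apply: eq_bigr => i _; rewrite inE; case: (P i).
rewrite !cE big_distrr -big_split /= expr_sum; apply: eq_bigr => i _.
rewrite /lwt tE; case B: (tnth a (g i)).2 => //=.
by rewrite L_g ?B // addn0; case: ltnP.
Qed.

End Sorted.

End Standardization.

(** * Words as sorting permutations with signs and sorted values *)

Section SortingPerm.
Variables (n : nat) (k : 'I_n -> nat).
Hypothesis k_inj : injective k.

Let rank j := #|[set i | k i < k j]%N|.

Let rank_lt i j : (k i < k j)%N -> (rank i < rank j)%N.
Proof.
move=> ij; apply: proper_card; apply/properP; split.
  by apply/fintype.subsetP => l; rewrite !inE => /ltn_trans; apply.
by exists i; rewrite !inE ?ltnn.
Qed.

Let rank_ltn j : (rank j < n)%N.
Proof.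
rewrite -[X in (_ < X)%N]card_ord -cardsT; apply: proper_card.
by rewrite properT; apply/eqP => /setP/(_ j); rewrite !inE ltnn.
Qed.

Let rank_inj : injective (fun j => Ordinal (rank_ltn j)).
Proof.
move=> i j /(congr1 val) /= E; apply: k_inj.
by case: (ltngtP (k i) (k j)) => // /rank_lt; rewrite E ltnn.
Qed.

Lemma sorting_perm : exists g : {perm 'I_n},
  forall i j : 'I_n, (i < j)%N -> (k (g i) < k (g j))%N.
Proof.
exists (perm rank_inj)^-1%g => i j ij.
have rK l : rank ((perm rank_inj)^-1%g l) = l.
  by have /(congr1 val) := permKV (perm rank_inj) l; rewrite permE.
rewrite ltnNge leq_eqVlt; apply/negP => /orP[/eqP/k_inj/perm_inj E|/rank_lt].
  by rewrite E ltnn in ij.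
by rewrite !rK ltnNge ltnW.
Qed.

Lemma sorting_perm_uniq (g g' : {perm 'I_n}) :
  (forall i j : 'I_n, (i < j)%N -> (k (g i) < k (g j))%N) ->
  (forall i j : 'I_n, (i < j)%N -> (k (g' i) < k (g' j))%N) -> g = g'.
Proof.
have rg (h : {perm 'I_n}) : (forall i j : 'I_n, (i < j)%N -> (k (h i) < k (h j))%N) ->
    forall i, rank (h i) = i.
  move=> H i; rewrite /rank -(card_imset _ (@perm_inj _ h^-1%g)).
  have -> : [set (h^-1)%g x | x in [set j | (k j < k (h i))%N]] =
    [set j : 'I_n | (j < i)%N].
    apply/setP => j; rewrite inE; apply/imsetP/idP => [[l]|ji]; last first.
      by exists (h j); rewrite ?permK // inE H.
    rewrite inE => kl ->; have lE : l = h (h^-1 l)%g by rewrite permKV.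
    rewrite ltnNge leq_eqVlt; apply/negP => /orP[/eqP/val_inj E|/H].
      by rewrite E permKV ltnn in kl.
    by rewrite permKV ltnNge ltnW.
  rewrite cardsE -sum1_card (eq_bigl (fun j : 'I_n => j < i)%N) //.
  by rewrite (big_ord_narrow (ltnW (ltn_ord i))) sum1_card card_ord.
move=> H H'; apply/permP => i; apply: rank_inj; apply: val_inj.
by rewrite /= !rg.
Qed.

End SortingPerm.

Section Compatible.
Variables (r n : nat).
Notation lev := 'I_r.+1.
Notation letter := ('I_r.+1 * bool)%type.
Notation triple := ({perm 'I_n} * {ffun 'I_n -> bool} * n.-tuple lev)%type.

Definition word_of (p : triple) : n.-tuple letter :=
  [tuple (tnth p.2 ((p.1.1)^-1%g j), p.1.2 ((p.1.1)^-1%g j)) | j < n].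

Definition triple_of (a : n.-tuple letter) : triple :=
  let g := odflt 1%g [pick g | sorts a g] in
  (g, [ffun i => (tnth a (g i)).2], [tuple (tnth a (g i)).1 | i < n]).

Lemma wkey_inj (a : n.-tuple letter) : injective (wkey a).
Proof.
move=> i j E; have := ltn_wkey a i j; have := ltn_wkey a j i; rewrite E ltnn.
move=> /esym/norP[ji N1] /esym/norP[ij N2].
have {ij ji}E1 : (tnth a i).1 = (tnth a j).1 by apply/ord_inj; lia.
rewrite E1 eqxx /= in N1 N2; move: N1 N2; rewrite !ltn_srank -!leNgt => N1 N2.
have /sval_int_inj[] : sval_int (i, (tnth a i).2) = sval_int (j,
  (tnth a j).2) by apply/le_anti; rewrite N1 N2.
by [].
Qed.

Lemma sorts_unique (a : n.-tuple letter) g g' : sorts a g -> sorts a g' -> g = g'.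
Proof.
have S h : sorts a h -> forall i j : 'I_n,
  (i < j)%N -> (wkey a (h i) < wkey a (h j))%N.
  by move=> H i j ij; have := forallP (forallP H i) j; rewrite ij.
by move=> /S H /S H'; apply: sorting_perm_uniq (@wkey_inj a) _ _ H H'.
Qed.

Lemma sorts_triple (a : n.-tuple letter) : sorts a (triple_of a).1.1.
Proof.
rewrite /triple_of /=; case: pickP => //= N.
have [g H] := sorting_perm (@wkey_inj a); suff : sorts a g by rewrite N.
by apply/forallP => i; apply/forallP => j; apply/implyP/H.
Qed.

Lemma tnth_word_of (p : triple) i :
  tnth (word_of p) (p.1.1 i) = (tnth p.2 i, p.1.2 i).
Proof. by rewrite tnth_mktuple permK. Qed.

Lemma triple_ofK (a : n.-tuple letter) : word_of (triple_of a) = a.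
Proof.
apply: eq_from_tnth => j.
have {1}-> : j = (triple_of a).1.1 (((triple_of a).1.1)^-1%g j) by rewrite permKV.
rewrite tnth_word_of /= tnth_mktuple ffunE permKV.
by case: (tnth a j).
Qed.

Lemma sum_triples (R : nmodType) (P : pred (n.-tuple letter)) (F : n.-tuple letter
  -> R) :
  \sum_(a | proper_word a && P a) F a =
  \sum_(p : triple | proper_word (word_of p) && sorts (word_of p) p.1.1 &&
    P (word_of p))
     F (word_of p).
Proof.
rewrite (reindex_onto word_of triple_of) /=; last by move=> a _; apply: triple_ofK.
apply: eq_bigl => p; rewrite -!andbA; congr (_ && _); rewrite andbC; congr (_ && _).
apply/eqP/idP => [<-|H]; first by rewrite triple_ofK sorts_triple.
case: p H => [[g e] f] /= H.
have gE := sorts_unique (sorts_triple (word_of (g, e, f))) H.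
rewrite /triple_of /= -/((triple_of (word_of (g, e, f))).1.1) in gE *.
rewrite gE; congr (_, _, _).
  by apply/ffunP => i; rewrite ffunE (tnth_word_of (g, e, f)).
by apply: eq_from_tnth => i; rewrite tnth_mktuple (tnth_word_of (g, e, f)).
Qed.

End Compatible.

(** * Signed permutations as permutations with signs *)

Section SignedPerm.
Variable n : nat.
Implicit Types (g : {perm 'I_n}) (e : {ffun 'I_n -> bool}).

Lemma signed_fun_inj g e :
  injective (fun x : signed_idx n => (g x.1, e x.1 (+) x.2)).
Proof.
move=> [i b] [j c] /= [/perm_inj ->] /addbI -> //.
Qed.

Definition signed_perm g e : {perm signed_idx n} := perm (signed_fun_inj (g := g)
  (e := e)).

Lemma signed_permP g e : signed_perm g e \in signed_perms n.
Proof.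
rewrite inE; apply/forallP => -[i b]; apply/eqP.
by rewrite !permE /sopp /= addbN.
Qed.

Definition abs_fun (w : {perm signed_idx n}) : {ffun 'I_n -> 'I_n} :=
  [ffun i => (w (i, false)).1].

Lemma abs_fun_inj w : w \in signed_perms n -> injectiveb (abs_fun w).
Proof.
rewrite inE => /forallP ws; apply/injectiveP => i j; rewrite !ffunE => E.
have [E2|E2] := eqVneq (w (i, false)).2 (w (j, false)).2.
  have /perm_inj[] : w (i, false) = w (j, false) by apply/eqP;
    rewrite -pair_eqE /pair_eq E E2 !eqxx.
  by [].
have /perm_inj[] // : w (i, false) = w (j, true).
rewrite (eqP (ws (j, false)) : w (j, true) = _) /sopp -E [LHS]surjective_pairing.
by congr pair; case: (w _).2 E2; case: (w _).2.
Qed.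

(** On [signed_perms n] the default 1 is never taken, by [abs_fun_inj]. *)
Definition abs_perm (w : {perm signed_idx n}) : {perm 'I_n} := insubd (1%g : {perm
  'I_n}) (abs_fun w).

Definition signs (w : {perm signed_idx n}) : {ffun 'I_n -> bool} :=
  [ffun i => (w (i, false)).2].

Lemma abs_permE w i : w \in signed_perms n -> abs_perm w i = (w (i, false)).1.
Proof.
move=> ws; have -> : abs_perm w i = abs_fun w i; last by rewrite ffunE.
rewrite -pvalE; congr (_ _); rewrite /abs_perm insubdK //.
exact: abs_fun_inj.
Qed.

Lemma sum_signed_perms (R : nmodType) (P : pred {perm signed_idx n}) (F : {perm
  signed_idx n} -> R) :
  \sum_(w in signed_perms n | P w) F w =
  \sum_(p : {perm 'I_n} * {ffun 'I_n -> bool} | P (signed_perm p.1 p.2))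
     F (signed_perm p.1 p.2).
Proof.
rewrite (reindex_onto (fun p => signed_perm p.1 p.2) (fun w =>
  (abs_perm w, signs w))) /=.
  apply: eq_bigl => -[g e]; rewrite signed_permP /= andbC.
  have -> : abs_perm (signed_perm g e) = g.
    by apply/permP => i; rewrite abs_permE ?signed_permP // permE.
  have -> : signs (signed_perm g e) = e.
    by apply/ffunP => i; rewrite ffunE permE /= addbF.
  by rewrite eqxx.
move=> w /andP[ws _]; apply/permP => -[i b]; rewrite permE /= abs_permE // ffunE.
case: b; last by rewrite addbF -surjective_pairing.
move: ws; rewrite inE => /forallP/(_ (i, false))/eqP -> /=.
by rewrite /sopp addbT.
Qed.

Lemma sentry_signed g e (i : 'I_n) :
  sentry (signed_perm g e) i.+1 = sval_int (g i, e i).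
Proof.
rewrite /sentry /= (nth_map i) ?size_enum_ord // nth_ord_enum permE /=.
by rewrite addbF.
Qed.

Lemma fexc_signed g e :
  fexc (signed_perm g e) =
  (2 * #|[pred i | ~~ e i && (i < g i)%N]| + #|[pred i | e i]|)%N.
Proof.
rewrite /fexc /exc /neg; congr (2 * _ + _)%N; apply: eq_card => i;
  rewrite !inE sentry_signed /sval_int /=.
  by case: (e i) => //=.
by case: (e i) => //=.
Qed.

(** In a word built from [g] and [e], the bit on the right is the sign of the first letter. *)
Lemma Xset_signed g e (i0 : 'I_n) : i0 = 0%N :> nat ->
  (signed_perm g e \in Xset n) = ~~ e ((g^-1)%g i0).
Proof.
move=> i00; rewrite inE signed_permP /=.
have E : ((signed_perm g e)^-1)%g (i0, false) = ((g^-1)%g i0, e ((g^-1)%g i0)).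
  apply: (@perm_inj _ (signed_perm g e)); rewrite permKV permE /= permKV.
  by rewrite addbb.
apply/forallP/idP => [/(_ (i0, false))|H [i b]].
  by rewrite E /sval_int /= i00 eqxx /=; case: (e _).
apply/implyP => /eqP; case: b => //; rewrite /sval_int /= => -[i1].
have -> : i = i0 by apply: ord_inj; rewrite i1.
by rewrite E /=; case: (e _) H.
Qed.

End SignedPerm.

(** These are compatible sequences in the sense of P-partitions, with [bs] marking the descents. *)
Fixpoint climbs (lo : nat) (bs : seq bool) (f : seq nat) : bool :=
  match bs, f with
  | b :: bs', x :: f' => (lo + b <= x)%N && climbs x bs' f'
  | _, _ => true
  end.

Lemma climbsP lo bs f : size bs = size f ->
  reflect (forall i, (i < size f)%N ->
     (nth 0%N (lo :: f) i + nth false bs i <= nth 0%N f i)%N)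
  (climbs lo bs f).
Proof.
elim: f bs lo => [|x f IH] [|b bs] lo //= => [_|[sz]]; first by constructor.
apply: (iffP andP) => [[lx /(IH _ _ sz) H] [|i] //|H]; first exact: H.
split; first exact: (H 0%N).
by apply/IH => // i; apply: (H i.+1).
Qed.

Lemma sum_binS n Y B : (B <= n)%N ->
  (\sum_(y < Y) 'C(y + n - B, n) = 'C(Y + n - B, n.+1))%N.
Proof.
move=> Bn; elim: Y => [|Y IH]; first by rewrite big_ord0 bin_small //; lia.
rewrite big_ord_recr /= IH; have -> : (Y.+1 + n - B = (Y + n - B).+1)%N by lia.
by rewrite binS.
Qed.

(** Summation over the first entry is the hockey-stick identity [sum_binS]; each true bit shortens
    the range by one. *)
Lemma sum_climbs r n lo bs : size bs = n -> (lo <= r)%N ->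
  (\sum_(f : n.-tuple 'I_r.+1) climbs lo bs [seq nat_of_ord x | x <- f] =
  'C(r - lo + n - count id bs, n))%N.
Proof.
elim: n bs lo => [|n IH] [|b bs] lo // => [_|[sz]] lor.
  rewrite bin0 (big_pred1 [tuple]) // => f.
  by apply/esym/eqP; rewrite [f]tuple0.
have cb : (count id bs <= n)%N by rewrite -sz count_size.
rewrite (big_tupleS _ n (fun f : seq 'I_r.+1 =>
  nat_of_bool (climbs lo (b :: bs) [seq nat_of_ord x | x <- f]))).
transitivity (\sum_(x < r.+1 | lo + b <= x) 'C(r - x + n - count id bs, n))%N.
  rewrite [RHS]big_mkcond; apply: eq_bigr => x _ /=.
  case: (leqP (lo + b) x) => _; last by rewrite big1_eq.
  by rewrite -IH ?leq_ord //.
rewrite (reindex_inj rev_ord_inj) /=.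
have [lbr|rlb] := leqP (lo + b) r; last first.
  rewrite big_pred0 => [|y]; last by rewrite subSS; lia.
  symmetry; apply: bin_small; move: cb; move: (count id bs) => c cb.
  by case: b rlb => /= rlb; lia.
have le1 : ((r - (lo + b)).+1 <= r.+1)%N by rewrite ltnS leq_subr.
rewrite (eq_bigl (fun y : 'I_r.+1 => y < (r - (lo + b)).+1)%N); last first.
  by move=> y; rewrite subSS; have := ltn_ord y; lia.
rewrite (big_ord_narrow le1) /=.
rewrite (eq_bigr (fun y : 'I_(r - (lo + b)).+1 => 'C(y + n - count id bs, n)));
  last first.
  by move=> y _; rewrite subSS subKn //; have := ltn_ord y; lia.
by rewrite sum_binS //; congr 'C(_, _); case: b lbr {le1} => /=; lia.
Qed.

Section Descents.
Variable n : nat.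

Definition descents (w : {perm signed_idx n}) : seq bool :=
  [seq (sentry w i.+1 < sentry w i) | i <- iota 0 n].

Lemma desBE w : desB w = count id (descents w).
Proof.
rewrite /desB /descents count_map -val_enum_ord count_map -size_filter.
by rewrite cardE; congr size; rewrite /enum_mem -filter_predI;
  apply: eq_filter => i; rewrite /= !inE andbT.
Qed.

Lemma nth_descents w i : (i < n)%N ->
  nth false (descents w) i = (sentry w i.+1 < sentry w i).
Proof. by move=> ilt; rewrite (nth_map 0%N) ?size_iota // nth_iota. Qed.

End Descents.

Section Compat.
Variables (r n : nat).
Notation lev := 'I_r.+1.
Notation letter := ('I_r.+1 * bool)%type.

(** Sorting is tested on neighbours, where equal values require an ascent of the signed entries. The
    possible descent at position 0 rules out the letter -0. *)
Lemma compat_climbs (g : {perm 'I_n}) (e : {ffun 'I_n -> bool}) (f : n.-tuple lev) :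
  proper_word (word_of (g, e, f)) && sorts (word_of (g, e, f)) g =
  climbs 0 (descents (signed_perm g e)) [seq nat_of_ord x | x <- f].
Proof.
pose a := word_of (g, e, f); rewrite -/a.
have aE i : tnth a (g i) = (tnth f i, e i) by exact: (tnth_word_of (g, e, f)).
have keyE i j : (wkey a (g i) < wkey a (g j))%N =
   (tnth f i < tnth f j)%N || (tnth f i == tnth f j) && (sval_int (g i,
     e i) < sval_int (g j, e j)).
  by rewrite ltn_wkey !aE ltn_srank.
have sz : size (descents (signed_perm g e)) = size [seq nat_of_ord x | x <- f].
  by rewrite !size_map size_iota size_tuple.
have fE (i : 'I_n) : nth 0%N [seq nat_of_ord x | x <- f] i = tnth f i.
  by rewrite (tnth_nth ord0) (nth_map ord0) // size_tuple.
apply/andP/(climbsP _ sz) => [[/forallP pa ga] i|H].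
  rewrite size_map size_tuple => ilt; rewrite nth_descents // (fE (Ordinal ilt)).
  rewrite (sentry_signed g e (Ordinal ilt)); case: i ilt => [|i] ilt /=.
    rewrite /sentry /= /sval_int /=; have := pa (g (Ordinal ilt)); rewrite aE /=.
    by case: (e _) => //=; rewrite lt0n.
  have ilt' := ltnW ilt; have := forallP (forallP ga (Ordinal ilt')) (Ordinal ilt).
  rewrite ltnSn /= keyE (fE (Ordinal ilt')) (sentry_signed g e (Ordinal ilt')).
  case/orP => [|/andP[/eqP -> /ltW]]; last by rewrite leNgt => /negPf ->;
    rewrite addn0.
  by case: (_ < _)%R => lt; rewrite ?addn1 // addn0 ltnW.
have step (i j : 'I_n) : j = i.+1 :> nat -> (wkey a (g i) < wkey a (g j))%N.
  move=> ji; have := H j; rewrite size_map size_tuple nth_descents // fE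
    sentry_signed.
  rewrite ji /= fE sentry_signed => /(_ ltac:(by rewrite -ji)); rewrite keyE.
  case: ltgtP => [_|lt|E].
  - by rewrite addn1 => ->.
  - by rewrite addn0 leq_eqVlt => /orP[/eqP/ord_inj ->|->] //; rewrite eqxx orbT.
  move/sval_int_inj: E => [/perm_inj E _]; move: ji; rewrite E; lia.
(* Along the initial run of zeros there is no descent, starting from [w_0 = 0], so no sign there is
   negative. *)
have pos (k : nat) (i : 'I_n) : i = k :> nat -> tnth f i = 0%N :> nat -> e i = false.
  elim: k i => [|k IH] i ik fi; have := H i;
    rewrite size_map size_tuple nth_descents // fE sentry_signed fi ik /= =>
    /(_ ltac:(by rewrite -ik)).
    by rewrite /sentry /= /sval_int /=; case: (e i).
  have klt : (k < n)%N by rewrite ltnW // -ik.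
  rewrite (fE (Ordinal klt)) (sentry_signed g e (Ordinal klt)) leqn0 addn_eq0 =>
    /andP[/eqP fk].
  have := IH (Ordinal klt) erefl fk; rewrite /sval_int /= => -> /=.
  by case: (e i) => //=; case: ltP => //; lia.
split.
  apply/forallP => j; have -> : j = g ((g^-1)%g j) by rewrite permKV.
  by rewrite aE /=; apply/andP => -[ei /eqP f0]; rewrite (pos _ _ erefl f0) in ei.
apply/forallP => i; apply/forallP => j; apply/implyP => ij.
have [k jk] : exists k, (j = i + k.+1 :> nat)%N by exists (j - i.+1)%N; lia.
elim: k j {ij} jk => [|k IH] j jk; first by apply: step; rewrite jk addn1.
have kn : (i + k.+1 < n)%N by have := ltn_ord j; lia.
apply: ltn_trans (IH (Ordinal kn) erefl) _.
by apply: step; rewrite jk addnS.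
Qed.

End Compat.

Lemma wordw_improper (K : comNzRingType) (s : K) r n (a : n.-tuple ('I_r.+1 * bool)) :
  ~~ proper_word a -> wordw s n a = 0.
Proof.
move=> /forallPn[j /negPn pj]; rewrite /wordw big_pred0 // => t.
by apply/negP => /andP[_ /validP[/(_ j)]]; rewrite pj.
Qed.

(** Standardization groups the words by signed permutation: a group has constant weight by
    [wordw_sorted] and its size is given by [sum_climbs]. *)
Lemma sum_fexc (K : comNzRingType) (s : K) r n : GRing.lreg (1 + s) ->
  \sum_(w in Xset n.+1) s ^+ fexc w * 'C(r + n.+1 - desB w, n.+1)%:R =
  \sum_(d : n.+1.-tuple 'I_(2 * r).+1 |
    (thead d <= r)%N) s ^+ ((jumpsum d).-1 %/ r)%N.
Proof.
move=> s1; rewrite -sum_walks -(sum_wordw _ _ s1).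
rewrite [RHS](bigID (fun a => proper_word a)) /= [X in _ + X]big1 ?addr0; last first.
  by move=> a /andP[_]; apply: wordw_improper.
under [RHS]eq_bigl do rewrite andbC.
rewrite (sum_triples (fun a => ~~ (thead a).2)) /=.
rewrite (eq_bigl (fun w => (w \in signed_perms n.+1) && (w \in Xset n.+1)));
  last first.
  by move=> w; rewrite [w \in Xset _]inE andbA andbb.
rewrite sum_signed_perms.
rewrite [RHS](eq_bigl (fun p : {perm 'I_n.+1} * {ffun 'I_n.+1 -> bool} *
  n.+1.-tuple 'I_r.+1 => (signed_perm p.1.1 p.1.2 \in Xset n.+1) &&
  climbs 0 (descents (signed_perm p.1.1 p.1.2)) [seq nat_of_ord x | x <- p.2]));
  last first.
  move=> [[g e] f] /=; rewrite compat_climbs andbC; congr (_ && _).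
  by rewrite (@Xset_signed _ g e ord0) // /thead tnth_mktuple.
rewrite -(pair_big_dep (fun q : {perm 'I_n.+1} * {ffun 'I_n.+1 -> bool} =>
  signed_perm q.1 q.2 \in Xset n.+1) (fun q (f : n.+1.-tuple 'I_r.+1) =>
  climbs 0 (descents (signed_perm q.1 q.2)) [seq nat_of_ord x |
  x <- f]) (fun q f => wordw s n.+1 (word_of (q, f)))).
apply: eq_bigr => -[g e] _; cbn [fst snd].
rewrite desBE -[r in X in X%:R](subn0 r) -sum_climbs ?size_map ?size_iota //.
rewrite natr_sum mulr_sumr [RHS]big_mkcond; apply: eq_bigr => f _.
rewrite -compat_climbs; case: andP => [[pa ga]|_]; last by rewrite mulr0n mulr0.
rewrite mulr1n mulr1 (wordw_sorted pa ga) fexc_signed.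
congr (s ^+ (2 * _ + _)%N); apply: eq_card => i;
  rewrite !inE (tnth_word_of (g, e, f)) //.
Qed.

(** Coefficients are compared in [sum_fexc] with the indeterminate as [s], for which [1 + s] is
    cancellable. *)
Lemma card_fexc r n k :
  (\sum_(w in Xset n.+1 | fexc w == k) 'C(r + n.+1 - desB w, n.+1) =
  #|[set d : n.+1.-tuple 'I_(2 * r).+1 | (thead d <= r) &&
    ((jumpsum d).-1 %/ r == k)]|)%N.
Proof.
have lr : GRing.lreg (1 + 'X : {poly int}).
  apply: mulfI; apply/eqP => /(congr1 (coefp 0)) /=.
  by rewrite coefD coefX coef1 coef0.
have := congr1 (coefp k) (sum_fexc r n lr); rewrite /= !coef_sum => E.
apply/eqP; rewrite -(eqr_nat int) -sum1dep_card !natr_sum; apply/eqP.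
rewrite big_mkcondr [RHS]big_mkcondr /=.
transitivity (\sum_(w in Xset n.+1) ('X^(fexc w) * 'C(r + n.+1 - desB w,
  n.+1)%:R : {poly int})`_k).
  apply: eq_bigr => w _; rewrite mulr_natr coefMn coefXn eq_sym.
  by case: eqP => _; rewrite ?mul0rn.
rewrite E; apply: eq_bigr => d _; rewrite coefXn eq_sym.
by case: eqP.
Qed.

(** * Cauchy products with powers of 1 - X *)

Definition convol (q : {poly int}) (a : nat -> int) (m : nat) : int :=
  \sum_(i < m.+1) q`_i * a (m - i)%N.

Lemma convol_1subX (q : {poly int}) a m :
  convol ((1 - 'X) * q) a m = convol q (fun t =>
    a t - (if t is t'.+1 then a t' else 0)) m.
Proof.
rewrite /convol.
under eq_bigr do rewrite mulrBl mul1r coefB coefXM mulrBl.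
under [RHS]eq_bigr do rewrite mulrBr.
rewrite !sumrB; congr (_ - _).
rewrite big_ord_recl /= mul0r add0r big_ord_recr /= subnn mulr0 addr0.
by apply: eq_bigr => i _; rewrite /bump /= add1n subnS; have := ltn_ord i;
  rewrite -subn_gt0; case: (m - i)%N.
Qed.

(** The expansion of X^D / (1 - X)^(n+1); a factor 1 - X takes differences, and Pascal's rule lowers
    [n]. *)
Lemma convol_bin n D m :
  convol ((1 - 'X) ^+ n.+1) (fun t =>
    if (D <= t)%N then 'C(t - D + n, n)%:Z else 0) m = (m == D)%:Z.
Proof.
have conv1 a : convol 1 a m = a m.
  rewrite /convol big_ord_recl coef1 mul1r subn0 big1 ?addr0 // => i _.
  by rewrite coef1 mul0r.
have ext q a b : a =1 b -> convol q a m = convol q b m.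
  by move=> ab; apply: eq_bigr => i _; rewrite ab.
elim: n => [|n IH].
  rewrite expr1 -[1 - 'X]mulr1 convol_1subX conv1 {conv1 ext}.
  case: m => [|m]; rewrite ?bin0.
    by rewrite subr0 leqn0 eq_sym; case: eqP.
  case: (ltngtP D m.+1) => [lt|lt|->].
  - by rewrite -ltnS lt subrr.
  - by rewrite leqNgt (ltnW lt) subrr.
  - by rewrite ltnn subr0.
rewrite exprS convol_1subX -[RHS]IH; apply: ext => -[|t].
  by rewrite subr0 leqn0; case: eqP => // ->; rewrite !binn.
case: (ltngtP D t.+1) => [lt|lt|->].
- rewrite -ltnS lt subSn // !addSn addnS binS PoszD addrAC subrr add0r.
  by [].
- by rewrite leqNgt (ltnW lt) subrr.
- by rewrite ltnn subr0 !subnn !add0n !binn.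
Qed.

(** * Lattice points of the half-open hypersimplices *)

(** The truncation in [y.-1] puts [y = 0] into the closed first slice. For [r = 0] the quotient is
    0, so only [k = 1] gives a nonempty slice. *)
Lemma slice_index r k y : (0 < k)%N -> (r = 0%N -> y = 0%N) ->
  (y.-1 %/ r == k - 1)%N = if k == 1%N
    then (y <= r)%N else ((k - 1) * r < y <= k * r)%N.
Proof.
move=> k0 ry; have [r0|r0] := posnP r.
  rewrite ry // r0 divn0 !muln0 ltnn /=; case: (k =P 1%N) => [->|k1] //.
  by apply/eqP; lia.
rewrite eqn_leq leq_divRL // -ltnS ltn_divLR // -[(k - 1).+1]addn1 subnK //.
case: (k =P 1%N) => [->|k1]; first by rewrite mul0n mul1n; lia.
case: y {ry} => [|y] /=; last by lia.
have : (0 < (k - 1) * r)%N by rewrite muln_gt0 r0 andbT; lia.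
by lia.
Qed.

Section Points.
Variables (R : realType) (n r : nat).
Notation jump := 'I_(2 * r).+1.

Definition psum (d : n.+1.-tuple jump) (i : nat) : nat :=
  (\sum_(j < n.+1 | j <= i) tnth d j)%N.

Definition point (d : n.+1.-tuple jump) : 'rV[R]_n.+1 :=
  \row_i ((psum d i)%:R / 2).

Lemma psum0 d : psum d 0 = tnth d ord0.
Proof. by rewrite /psum (big_pred1 ord0) // => j; rewrite leqn0. Qed.

Lemma psumS d (j : 'I_n.+1) i : j = i.+1 :> nat -> psum d j = (psum d i + tnth d j)%N.
Proof.
move=> ji; rewrite /psum (bigD1 j) //= addnC; congr addn; apply: eq_bigl => l.
by rewrite -val_eqE /= ji; lia.
Qed.

Lemma psum_max d : psum d n = jumpsum d.
Proof.
rewrite /jumpsum sumnE big_map /psum -[in RHS](map_tnth_enum d) big_map big_enum.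
by apply: eq_bigl => j; rewrite -ltnS ltn_ord.
Qed.

Lemma point_inj : injective point.
Proof.
move=> d d' /rowP E; have {}E (i : 'I_n.+1) : psum d i = psum d' i.
  have := E i; rewrite !mxE => /mulIf H; apply/eqP; rewrite -(eqr_nat R).
  by apply/eqP/H; rewrite invr_neq0 // pnatr_eq0.
apply: eq_from_tnth => i; apply: ord_inj.
case: (posnP i) => [i0|i0].
  have -> : i = ord0 by apply: ord_inj.
  by rewrite -!psum0 (E ord0).
have il : (i.-1 < n.+1)%N by have := ltn_ord i; lia.
have ii : i = (Ordinal il).+1 :> nat by rewrite /= prednK.
by have := E i; rewrite !(psumS _ ii) (E (Ordinal il)) => /addnI.
Qed.

Lemma psum_r0 d i : r = 0%N -> psum d i = 0%N.
Proof.
move=> r0; rewrite /psum big1 // => j _.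
by have := ltn_ord (tnth d j); move: (nat_of_ord _) => x; rewrite r0; lia.
Qed.

Lemma mul2_half (x : R) : 2 * (x / 2) = x.
Proof. by rewrite mulrC divfK // pnatr_eq0. Qed.

Lemma DeltaC_point k d : (0 < k)%N ->
  @DeltaC R n.+1 k r (point d) <->
  (thead d <= r)%N && ((jumpsum d).-1 %/ r == k - 1)%N.
Proof.
move=> k0; rewrite slice_index //; last by rewrite -psum_max; apply: psum_r0.
have last_cond (i : 'I_n.+1) : i.+1 = n.+1 ->
   (if k == 1%N then 0 <= 2 * point d 0 i <= r%:R
      else (k%:R - 1) * r%:R < 2 * point d 0 i <= k%:R * r%:R) =
   (if k == 1%N then (jumpsum d <= r)%N else ((k - 1) * r < jumpsum d <= k * r)%N).
  move=> [iE]; rewrite mxE mul2_half iE psum_max ler0n ler_nat.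
  rewrite -(natrB _ k0) -!natrM ltr_nat ler_nat.
  by case: ifP.
split=> [[[H0 _] Hl]|/andP[d0 dl]].
  rewrite -(last_cond ord_max) // Hl // andbT.
  have := H0 ord0 erefl; rewrite mxE mul2_half psum0 ler_nat.
  by case/andP.
split; last by move=> i iE; rewrite last_cond.
split=> [i i0|i j ji].
  by rewrite mxE mul2_half i0 psum0 ler0n ler_nat.
rewrite !mxE (psumS _ ji) natrD mulrDl addrAC subrr add0r.
rewrite divr_ge0 ?ler0n //= ler_pdivrMr ?ltr0n // -natrM ler_nat.
by have := ltn_ord (tnth d j); move: (nat_of_ord (tnth d j)) => y; lia.
Qed.

Lemma half_lattice_point d : @half_lattice R n.+1 (point d).
Proof. by move=> i; exists (psum d i)%:Z; rewrite mxE. Qed.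

Lemma point_surj k (x : 'rV[R]_n.+1) : @DeltaC R n.+1 k r x -> @half_lattice R n.+1
  x ->
  exists d, x = point d.
Proof.
move=> [[H0 H1] _] /boolp.choice[z xz].
(* The jumps are the differences of the integers 2 x_i; the inequalities of [PiC] keep them between
   0 and [2 * r]. *)
pose zz (i : nat) : int := if i is i'.+1
  then z (inord i'.+1) - z (inord i') else z (inord 0).
have zzP (i : 'I_n.+1) : 0 <= zz i <= (2 * r)%:Z.
  case: i => [[|i] ilt] /=.
    have := H0 (inord 0); rewrite inordK // xz mul2_half => /(_ erefl).
    rewrite ler0z -[r%:R]/(r%:Z%:~R) ler_int; lia.
  have := H1 (inord i) (inord i.+1); rewrite !inordK ?(ltnW ilt) // => /(_ erefl).
  rewrite !xz -mulrBl -intrB => /andP[h1 h2]; apply/andP; split.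
    by move: h1; rewrite pmulr_lge0 ?invr_gt0 ?ltr0n // ler0z.
  move: h2; rewrite ler_pdivrMr ?ltr0n // -natrM -[(r * 2)%:R]/((r * 2)%:Z%:~R)
    ler_int.
  by rewrite mulnC.
exists [tuple inord `|zz i|%N | i < n.+1].
apply/rowP => i; rewrite mxE xz; congr (_ / 2).
rewrite -[_%:R]/((Posz _)%:~R); congr (_%:~R).
have tE (j : 'I_n.+1) : (tnth [tuple inord `|zz i|%N | i < n.+1] j : jump)%:Z = zz j.
  by rewrite tnth_mktuple inordK; have := zzP j; lia.
case: i => i ilt; elim: i ilt => [|i IH] ilt.
  rewrite psum0 tE /=; congr z; apply: ord_inj; by rewrite /= inordK.
rewrite (psumS _ (erefl : Ordinal ilt = i.+1 :> nat)) PoszD tE -(IH (ltnW ilt)) /=.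
have -> : inord i.+1 = Ordinal ilt by apply: ord_inj; rewrite inordK.
have -> : inord i = Ordinal (ltnW ilt) by apply: ord_inj; rewrite inordK // ltnW.
by rewrite addrC subrK.
Qed.

Lemma card_DeltaC k : (0 < k)%N ->
  (@DeltaC R n.+1 k r `&` @half_lattice R n.+1 #=
  `I_ #|[set d : n.+1.-tuple jump | (thead d <= r)%N &&
    ((jumpsum d).-1 %/ r == k - 1)%N]|)%card.
Proof.
move=> k0; set D := [set d | _]%SET.
have -> : (@DeltaC R n.+1 k r `&` @half_lattice R n.+1 = (fun i : 'I_#|D| =>
  point (enum_val i)) @` setT)%classic.
  apply/seteqP; split=> [x [Dx Hx]|x [i _ <-]].
    have [d xd] := point_surj Dx Hx; subst x.
    have dD : d \in D by rewrite inE; apply/DeltaC_point.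
    by exists (enum_rank_in dD d) => //; rewrite enum_rankK_in.
  split; last exact: half_lattice_point.
  by apply/DeltaC_point => //; have := enum_valP i; rewrite inE.
apply: card_eq_trans (inj_card_eq _) _; last by rewrite card_eq_sym; apply: card_II.
by move=> i j _ _ /point_inj/enum_val_inj.
Qed.

End Points.

Lemma desB_le n (w : {perm signed_idx n}) : (desB w <= n)%N.
Proof. by rewrite /desB -[X in (_ <= X)%N]card_ord max_card. Qed.

Theorem theoremB (R : realType) (n k : nat) (hn : (1 <= n)%N) (hk : (1 <= k)%N) :
  is_hstar (@DeltaC R n k)
    (\sum_(w in Xset n | fexc w == (k - 1)%N) 'X^(desB w)).
Proof.
case: n hn => // n _.
exists (fun r => #|[set d : n.+1.-tuple 'I_(2 * r).+1 | (thead d <= r) &&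
  ((jumpsum d).-1 %/ r == k - 1)]|%N).
  by move=> r; apply: card_DeltaC.
move=> m; under eq_bigr do rewrite -card_fexc.
rewrite coef_sum.
(* Each binomial is put into the form used by [convol_bin], a sequence that vanishes below the index
   [desB w]. *)
transitivity (\sum_(i < m.+1) \sum_(w in Xset n.+1 | fexc w == (k - 1)%N)
   ((1 - 'X) ^+ n.+2)`_i * (if (desB w <= m - i)%N then 'C(m - i - desB w + n.+1,
     n.+1)%:Z else 0)).
  apply: eq_bigr => i _; rewrite -mulr_sumr; congr (_ * _).
  rewrite -[LHS]natz natr_sum; apply: eq_bigr => w _.
  rewrite natz; case: leqP => H; first by rewrite (addnBAC _ H).
  rewrite bin_small //; move: H (desB_le w); move: (m - i)%N (desB w) => x y; lia.
rewrite exchange_big; apply: eq_bigr => w _; rewrite coefXn natz -(convol_bin n.+1).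
by [].
Qed.
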